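(* Let $\mathscr{C}$ be a finitely cocomplete regular Mal'tsev category. Then the category $2\text{-}\mathrm{Grpd}(\mathscr{C})$ of internal $2$-groupoids in $\mathscr{C}$ is a Birkhoff subcategory of the category $\mathrm{Grpd}^2(\mathscr{C})$ of internal double groupoids in $\mathscr{C}$.
   Context: Regular category: a finitely complete category which has coequalizers of kernel pairs and in which regular epimorphisms are pullback stable. Mal'tsev category: a finitely complete category in which every internal reflexive relation is an equivalence relation. Internal groupoids: for a finitely complete category $\mathscr{C}$, $\mathrm{Grpd}(\mathscr{C})$ is the category of internal groupoids in $\mathscr{C}$ and internal functors. An internal groupoid consists of a reflexive graph $d,c\colon C_1\to C_0$, $e\colon C_0\to C_1$ with $de=1_{C_0}=ce$, together with a composition $m\colon C_1\times_{C_0}C_1\to C_1$ and an inverse $i\colon C_1\to C_1$ satisfying the usual axioms. The category $\mathrm{Grpd}(\mathscr{C})$ is finitely complete, with limits computed levelwise. Double groupoids: $\mathrm{Grpd}^2(\mathscr{C}):=\mathrm{Grpd}(\mathrm{Grpd}(\mathscr{C}))$. A double groupoid $\mathbb{C}$ has an underlying double reflexive graph: objects $C^i_j$ ($i,j\in\{0,1\}$), horizontal reflexive graphs $d^i,c^i\colon C^i_1\to C^i_0$, $e^i\colon C^i_0\to C^i_1$ ($i=0,1$), and vertical reflexive graphs $d_j,c_j\colon C^1_j\to C^0_j$, $e_j\colon C^0_j\to C^1_j$ ($j=0,1$), with the horizontal and vertical structures commuting with each other; each of these reflexive graphs underlies an internal groupoid. $2$-groupoids: $2\text{-}\mathrm{Grpd}(\mathscr{C})$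 is the full subcategory of $\mathrm{Grpd}^2(\mathscr{C})$ whose objects are the double groupoids for which $e^0\colon C^0_0\to C^0_1$ is an isomorphism. Birkhoff subcategory: a replete (closed under isomorphisms) full reflective subcategory $\mathscr{X}$ of a category $\mathscr{A}$ is a Birkhoff subcategory if it is closed in $\mathscr{A}$ under subobjects (if $A\to X$ is a monomorphism in $\mathscr{A}$ with $X\in\mathscr{X}$ then $A\in\mathscr{X}$) and under regular quotients (if $X\to A$ is a regular epimorphism in $\mathscr{A}$ with $X\in\mathscr{X}$ then $A\in\mathscr{X}$). *)

(* Defs.v *)
(* Morphisms of a category are compared with Leibniz equality. *)
From Stdlib Require Import List ProofIrrelevance.

Set Implicit Arguments.
Unset Strict Implicit.
Unset Printing Implicit Defensive.

Record Category := {
  ob :> Type;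
  hom : ob -> ob -> Type;
  idm : forall a, hom a a;
  comp : forall a b c, hom b c -> hom a b -> hom a c;
  comp_idl : forall a b (f : hom a b), comp (idm b) f = f;
  comp_idr : forall a b (f : hom a b), comp f (idm a) = f;
  comp_assoc : forall a b c d (h : hom c d) (g : hom b c) (f : hom a b),
    comp h (comp g f) = comp (comp h g) f
}.

Arguments hom {_} _ _.
Arguments idm {_} _.
Arguments comp {_ _ _ _} _ _.

Declare Scope cat_scope.
Notation "g ∘ f" := (comp g f) (at level 40, left associativity) : cat_scope.
Local Open Scope cat_scope.

Record Functor (A B : Category) := {
  fob :> A -> B;
  fmap : forall a b, hom a b -> hom (fob a) (fob b);
  fmap_id : forall a, fmap (idm a) = idm (fob a);
  fmap_comp : forall a b c (g : hom b c) (f : hom a b),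
    fmap (g ∘ f) = fmap g ∘ fmap f
}.

Arguments fmap {_ _} _ {_ _} _.

Section Morphisms.
Variable C : Category.

Definition is_iso (a b : C) (f : hom a b) : Prop :=
  exists g : hom b a, g ∘ f = idm a /\ f ∘ g = idm b.

Definition isomorphic (a b : C) : Prop := exists f : hom a b, is_iso f.

Definition monic (a b : C) (f : hom a b) : Prop :=
  forall x (u v : hom x a), f ∘ u = f ∘ v -> u = v.

Definition jointly_monic (r a b : C) (f : hom r a) (g : hom r b) : Prop :=
  forall x (u v : hom x r), f ∘ u = f ∘ v -> g ∘ u = g ∘ v -> u = v.

Definition is_coequalizer (a b q : C) (u v : hom a b) (f : hom b q) : Prop :=
  f ∘ u = f ∘ v /\
  forall x (g : hom b x), g ∘ u = g ∘ v -> exists! h : hom q x, h ∘ f = g.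

Definition regular_epi (b q : C) (f : hom b q) : Prop :=
  exists (a : C) (u v : hom a b), is_coequalizer u v f.

Definition is_pullback (a b z p : C) (f : hom a z) (g : hom b z)
    (p1 : hom p a) (p2 : hom p b) : Prop :=
  f ∘ p1 = g ∘ p2 /\
  forall x (u : hom x a) (v : hom x b), f ∘ u = g ∘ v ->
    exists! w : hom x p, p1 ∘ w = u /\ p2 ∘ w = v.

Definition is_kernel_pair (a b k : C) (f : hom a b) (p1 p2 : hom k a) : Prop :=
  is_pullback f f p1 p2.

End Morphisms.

Definition finite_category (J : Category) : Prop :=
  (exists l : list J, forall j, In j l) /\
  (forall i j : J, exists l : list (hom i j), forall f, In f l).

Definition is_cone (J C : Category) (D : Functor J C) (x : C)
    (p : forall j, hom x (D j)) : Prop :=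
  forall i j (f : hom i j), fmap D f ∘ p i = p j.

Definition is_limit (J C : Category) (D : Functor J C) (l : C)
    (p : forall j, hom l (D j)) : Prop :=
  is_cone p /\
  forall x (q : forall j, hom x (D j)), is_cone q ->
    exists! h : hom x l, forall j, p j ∘ h = q j.

Definition is_cocone (J C : Category) (D : Functor J C) (x : C)
    (p : forall j, hom (D j) x) : Prop :=
  forall i j (f : hom i j), p j ∘ fmap D f = p i.

Definition is_colimit (J C : Category) (D : Functor J C) (l : C)
    (p : forall j, hom (D j) l) : Prop :=
  is_cocone p /\
  forall x (q : forall j, hom (D j) x), is_cocone q ->
    exists! h : hom l x, forall j, h ∘ p j = q j.

Definition finitely_complete (C : Category) : Prop :=
  forall (J : Category) (D : Functor J C), finite_category J ->
    exists (l : C) (p : forall j, hom l (D j)), is_limit p.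

Definition finitely_cocomplete (C : Category) : Prop :=
  forall (J : Category) (D : Functor J C), finite_category J ->
    exists (l : C) (p : forall j, hom (D j) l), is_colimit p.

Record regular_category (C : Category) : Prop := {
  regular_complete : finitely_complete C;
  regular_coequalizers :
    forall (a b k : C) (f : hom a b) (p1 p2 : hom k a), is_kernel_pair f p1 p2 ->
      exists (q : C) (r : hom a q), is_coequalizer p1 p2 r;
  regular_stable :
    forall (a b z p : C) (f : hom a z) (g : hom b z) (p1 : hom p a) (p2 : hom p b),
      is_pullback f g p1 p2 -> regular_epi f -> regular_epi p2
}.

Section Relations.
Variable C : Category.

Definition is_relation (r a : C) (r1 r2 : hom r a) : Prop := jointly_monic r1 r2.

Definition reflexive_rel (r a : C) (r1 r2 : hom r a) : Prop :=
  exists s : hom a r, r1 ∘ s = idm a /\ r2 ∘ s = idm a.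

Definition symmetric_rel (r a : C) (r1 r2 : hom r a) : Prop :=
  exists s : hom r r, r1 ∘ s = r2 /\ r2 ∘ s = r1.

(* [p] is the object of pairs of related pairs ((x, y), (y, z)). *)
Definition transitive_rel (r a : C) (r1 r2 : hom r a) : Prop :=
  forall (p : C) (p1 p2 : hom p r), is_pullback r2 r1 p1 p2 ->
    exists t : hom p r, r1 ∘ t = r1 ∘ p1 /\ r2 ∘ t = r2 ∘ p2.

Definition is_equivalence_relation (r a : C) (r1 r2 : hom r a) : Prop :=
  is_relation r1 r2 /\ reflexive_rel r1 r2 /\
  symmetric_rel r1 r2 /\ transitive_rel r1 r2.

End Relations.

Record maltsev_category (C : Category) : Prop := {
  maltsev_complete : finitely_complete C;
  maltsev_equivalence :
    forall (r a : C) (r1 r2 : hom r a), is_relation r1 r2 -> reflexive_rel r1 r2 ->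
      is_equivalence_relation r1 r2
}.

(* The object [gr_pairs] of composable pairs is a pullback carried by the
   groupoid, rather than a pullback chosen once and for all in [C]; since an
   internal functor is only its object and arrow components, in a category with
   pullbacks this gives the same category up to equivalence, and it can be
   iterated without choosing limits in the category of groupoids.
   A pair (g, f) is composable when dom g = cod f, and [gr_comp] sends it to
   the composite of f followed by g.  A morphism into C_1 x_{C_0} C_1 with
   prescribed components exists and is unique by [gr_pullback], so the axioms
   refer to such a morphism as any [w] having these components. *)
Record Groupoid (C : Category) := {
  gr_ob : C;
  gr_arr : C;
  gr_dom : hom gr_arr gr_ob;
  gr_cod : hom gr_arr gr_ob;
  gr_unit : hom gr_ob gr_arr;
  gr_pairs : C;
  gr_fst : hom gr_pairs gr_arr;
  gr_snd : hom gr_pairs gr_arr;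
  gr_comp : hom gr_pairs gr_arr;
  gr_inv : hom gr_arr gr_arr;
  gr_pullback : is_pullback gr_dom gr_cod gr_fst gr_snd;
  gr_dom_unit : gr_dom ∘ gr_unit = idm gr_ob;
  gr_cod_unit : gr_cod ∘ gr_unit = idm gr_ob;
  gr_dom_comp : gr_dom ∘ gr_comp = gr_dom ∘ gr_snd;
  gr_cod_comp : gr_cod ∘ gr_comp = gr_cod ∘ gr_fst;
  gr_comp_unit_r : forall w : hom gr_arr gr_pairs,
    gr_fst ∘ w = idm gr_arr -> gr_snd ∘ w = gr_unit ∘ gr_dom ->
    gr_comp ∘ w = idm gr_arr;
  gr_comp_unit_l : forall w : hom gr_arr gr_pairs,
    gr_fst ∘ w = gr_unit ∘ gr_cod -> gr_snd ∘ w = idm gr_arr ->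
    gr_comp ∘ w = idm gr_arr;
  (* hg = (h, g), gf = (g, f), l = (h g, f) and r = (h, g f), as generalized
     elements at stage x *)
  gr_comp_assoc : forall (x : C) (hg gf l r : hom x gr_pairs),
    gr_snd ∘ hg = gr_fst ∘ gf ->
    gr_fst ∘ l = gr_comp ∘ hg -> gr_snd ∘ l = gr_snd ∘ gf ->
    gr_fst ∘ r = gr_fst ∘ hg -> gr_snd ∘ r = gr_comp ∘ gf ->
    gr_comp ∘ l = gr_comp ∘ r;
  gr_dom_inv : gr_dom ∘ gr_inv = gr_cod;
  gr_cod_inv : gr_cod ∘ gr_inv = gr_dom;
  gr_comp_inv_l : forall w : hom gr_arr gr_pairs,
    gr_fst ∘ w = gr_inv -> gr_snd ∘ w = idm gr_arr ->
    gr_comp ∘ w = gr_unit ∘ gr_dom;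
  gr_comp_inv_r : forall w : hom gr_arr gr_pairs,
    gr_fst ∘ w = idm gr_arr -> gr_snd ∘ w = gr_inv ->
    gr_comp ∘ w = gr_unit ∘ gr_cod
}.

Record InternalFunctor (C : Category) (G H : Groupoid C) := {
  if_ob : hom (gr_ob G) (gr_ob H);
  if_arr : hom (gr_arr G) (gr_arr H);
  if_dom : gr_dom H ∘ if_arr = if_ob ∘ gr_dom G;
  if_cod : gr_cod H ∘ if_arr = if_ob ∘ gr_cod G;
  if_unit : if_arr ∘ gr_unit G = gr_unit H ∘ if_ob;
  if_comp : forall w : hom (gr_pairs G) (gr_pairs H),
    gr_fst H ∘ w = if_arr ∘ gr_fst G -> gr_snd H ∘ w = if_arr ∘ gr_snd G ->
    if_arr ∘ gr_comp G = gr_comp H ∘ w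
}.

Lemma internal_functor_eq (C : Category) (G H : Groupoid C)
    (F F' : InternalFunctor G H) :
  if_ob F = if_ob F' -> if_arr F = if_arr F' -> F = F'.
Proof.
destruct F as [o a h1 h2 h3 h4], F' as [o' a' h1' h2' h3' h4']; simpl.
intros E1 E2; subst o' a'; f_equal; apply proof_irrelevance.
Qed.

Definition internal_id (C : Category) (G : Groupoid C) : InternalFunctor G G.
Proof.
refine {| if_ob := idm (gr_ob G); if_arr := idm (gr_arr G) |}.
- now rewrite comp_idl, comp_idr.
- now rewrite comp_idl, comp_idr.
- now rewrite comp_idl, comp_idr.
- intros w h1 h2; rewrite comp_idl in *.
  destruct (proj2 (gr_pullback G) _ _ _ (proj1 (gr_pullback G))) as [v [_ Hv]].
  assert (E : w = idm (gr_pairs G)).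
  { transitivity v; [symmetry|]; apply Hv; split; trivial; apply comp_idr. }
  now rewrite E, comp_idr.
Defined.

Definition internal_comp (C : Category) (G H K : Groupoid C)
    (F' : InternalFunctor H K) (F : InternalFunctor G H) : InternalFunctor G K.
Proof.
refine {| if_ob := if_ob F' ∘ if_ob F; if_arr := if_arr F' ∘ if_arr F |}.
- now rewrite comp_assoc, if_dom, <- !comp_assoc, if_dom.
- now rewrite comp_assoc, if_cod, <- !comp_assoc, if_cod.
- now rewrite <- comp_assoc, if_unit, !comp_assoc, if_unit.
- intros w h1 h2.
  assert (EG : gr_dom H ∘ (if_arr F ∘ gr_fst G) = gr_cod H ∘ (if_arr F ∘ gr_snd G)).
  { rewrite !comp_assoc, if_dom, if_cod, <- !comp_assoc.
    now rewrite (proj1 (gr_pullback G)). }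
  destruct (proj2 (gr_pullback H) _ _ _ EG) as [u [[u1 u2] _]].
  assert (EH : gr_dom K ∘ (if_arr F' ∘ gr_fst H) = gr_cod K ∘ (if_arr F' ∘ gr_snd H)).
  { rewrite !comp_assoc, if_dom, if_cod, <- !comp_assoc.
    now rewrite (proj1 (gr_pullback H)). }
  destruct (proj2 (gr_pullback K) _ _ _ EH) as [v [[v1 v2] _]].
  assert (EK : gr_dom K ∘ (gr_fst K ∘ w) = gr_cod K ∘ (gr_snd K ∘ w)).
  { now rewrite !comp_assoc, (proj1 (gr_pullback K)). }
  destruct (proj2 (gr_pullback K) _ _ _ EK) as [t [_ Ht]].
  assert (E : w = v ∘ u).
  { transitivity t; [symmetry|]; apply Ht; split; trivial.
    - now rewrite comp_assoc, v1, <- comp_assoc, u1, h1, comp_assoc.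
    - now rewrite comp_assoc, v2, <- comp_assoc, u2, h2, comp_assoc. }
  rewrite <- comp_assoc, (if_comp u1 u2), comp_assoc, (if_comp v1 v2), E.
  now rewrite comp_assoc.
Defined.

Definition Grpd (C : Category) : Category.
Proof.
refine {| ob := Groupoid C; hom := @InternalFunctor C;
          idm := @internal_id C; comp := @internal_comp C |}.
- intros G H F; apply internal_functor_eq; apply comp_idl.
- intros G H F; apply internal_functor_eq; apply comp_idr.
- intros G H K L F'' F' F; apply internal_functor_eq; apply comp_assoc.
Defined.

Definition Grpd2 (C : Category) : Category := Grpd (Grpd C).

(* For a double groupoid D, the internal groupoids in C that are its objects of
   objects and of arrows are the horizontal groupoids C^0 = (C^0_1 => C^0_0) and
   C^1 = (C^1_1 => C^1_0); the vertical structure d_j, c_j, e_j is given by the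
   components of gr_dom D, gr_cod D, gr_unit D.  So e^0 : C^0_0 -> C^0_1 is the
   unit of [gr_ob D]. *)
Definition is_two_groupoid (C : Category) (D : Grpd2 C) : Prop :=
  let C0 : Groupoid C := gr_ob (D : Groupoid (Grpd C)) in
  is_iso (gr_unit C0).

(* A full subcategory of [A] is given by a predicate on the objects of [A]. *)
Definition full_subcategory (A : Category) (P : A -> Prop) : Category := {|
  ob := {a : A | P a};
  hom x y := hom (proj1_sig x) (proj1_sig y);
  idm x := idm (proj1_sig x);
  comp x y z g f := g ∘ f;
  comp_idl x y f := comp_idl f;
  comp_idr x y f := comp_idr f;
  comp_assoc x y z t h g f := comp_assoc h g f
|}.

Definition inclusion (A : Category) (P : A -> Prop) :
    Functor (full_subcategory P) A :=
  @Build_Functor (full_subcategory P) A (fun x => proj1_sig x) (fun x y f => f)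
    (fun x => eq_refl) (fun x y z g f => eq_refl).

Definition TwoGrpd (C : Category) : Category :=
  full_subcategory (@is_two_groupoid C).

Record Adjunction (A X : Category) (L : Functor A X) (R : Functor X A) := {
  adj : forall (a : A) (x : X), hom (L a) x -> hom a (R x);
  adj_inv : forall (a : A) (x : X), hom a (R x) -> hom (L a) x;
  adj_invK : forall a x (f : hom a (R x)), adj (adj_inv f) = f;
  adjK : forall a x (g : hom (L a) x), adj_inv (adj g) = g;
  adj_natural_l : forall a b x (f : hom a b) (g : hom (L b) x),
    adj (g ∘ fmap L f) = adj g ∘ f;
  adj_natural_r : forall a x y (g : hom (L a) x) (h : hom x y),
    adj (h ∘ g) = fmap R h ∘ adj g
}.

Definition has_left_adjoint (A X : Category) (R : Functor X A) : Prop :=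
  exists L : Functor A X, inhabited (Adjunction L R).

Record birkhoff_subcategory (A : Category) (P : A -> Prop) : Prop := {
  birkhoff_replete : forall a b : A, isomorphic a b -> P a -> P b;
  birkhoff_reflective : has_left_adjoint (inclusion P);
  birkhoff_subobjects : forall (a x : A) (f : hom a x), monic f -> P x -> P a;
  birkhoff_quotients : forall (x a : A) (f : hom x a), regular_epi f -> P x -> P a
}.

(* Main.v *)
Require Import Defs.
From Stdlib Require Import List ProofIrrelevance ClassicalEpsilon.

Set Implicit Arguments.
Unset Strict Implicit.
Unset Printing Implicit Defensive.

Local Open Scope cat_scope.

(** A double groupoid A consists of a horizontal groupoid A^0 of objects, a horizontal
    groupoid A^1 of arrows and a vertical groupoid structure on them in the category of
    groupoids; it is a 2-groupoid when A^0 is discrete.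

    Closure under subobjects and quotients is formal.  The functor that takes the object of objects of an internal groupoid has a left adjoint,
    the discrete groupoid, and a right adjoint, the indiscrete groupoid; so it preserves
    monomorphisms ([monic_ob]) and coequalizers ([coequalizer_ob]), and it is enough to
    consider A^0.  Among groupoids, the discrete ones are closed under subobjects
    ([discrete_subobject]), and also under regular quotients because they are
    coreflective and the counit is a monomorphism ([discrete_quotient]).

    The reflection Q of A is found by making A^0 discrete in the cheapest way.  Let P be
    the coequalizer of the domain and codomain of A^0.  Then Q^0 is the discrete groupoid
    on P, and the two objects of Q^1 are the pushouts, along the quotient maps from A^0 to
    Q^0, of the components of the vertical unit A^0 -> A^1.  The universal property of
    pushouts makes Q a double reflexive graph, of which A is a cover by regular
    epimorphisms, and gives the required factorizations at the level of graphs.  It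
    remains to see that Q is a double groupoid and that morphisms of graphs are functors,
    and for this the Mal'tsev property is used, in the following form: a relation from X
    to Y is difunctional, so that if X and Y are split over B, then a subobject of the
    pullback of X and Y over B that contains both sections is everything
    ([subobject_containing_sections]), and the two sections are jointly epimorphic
    ([sections_jointly_epic]).  For the composable pairs of a reflexive graph the sections
    are the pairs (f, 1) and (1, g), and three things follow.

    - A composition on a reflexive graph that satisfies the unit laws makes it into a
      groupoid ([multiplicative_graph_groupoid]).

    - A morphism of reflexive graphs between groupoids is a functor
      ([graph_morphism_comp]).  This extends to groupoids in the category of groupoids,
      because the evaluations at objects and at arrows preserve pullbacks
      ([groupoids_pairs_generated]).

    - If a groupoid G covers a reflexive graph by regular epimorphisms, the graph is a
      groupoid ([quotient_groupoid]): pairs of arrows of the quotient lift to G, since the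
      image of the pairs of G contains the pairs (f, 1) and (1, g), and the composite does
      not depend on the lifting.

    The four reflexive graphs of Q are thus groupoids, and [levelwise_groupoid] assembles
    them into a double groupoid. *)

Lemma post_comp (C : Category) (t a b c : C) (f : hom b c) (g : hom a b)
    (k : hom a c) (E : f ∘ g = k) (u : hom t a) : f ∘ (g ∘ u) = k ∘ u.
Proof. now rewrite comp_assoc, E. Qed.

Lemma post_comp3 (C : Category) (t a b c d : C) (f : hom c d) (g : hom b c)
    (h : hom a b) (k : hom a d) (E : f ∘ (g ∘ h) = k) (u : hom t a) :
  f ∘ (g ∘ (h ∘ u)) = k ∘ u.
Proof. now rewrite <- E, !comp_assoc. Qed.

Ltac cnorm := rewrite <- ?comp_assoc, ?comp_idl, ?comp_idr.
(** Rewriting of composites up to associativity. *)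
Tactic Notation "crw" constr(E) :=
  cnorm; first [rewrite !E | rewrite !(post_comp E) | rewrite !(post_comp3 E)]; cnorm.
Tactic Notation "crw" "<-" constr(E) := crw (eq_sym E).

(** * Finite limits and coequalizers *)

Definition discrete_category (I : Type) : Category.
Proof.
refine {| ob := I; hom := fun i j => i = j; idm := @eq_refl I;
          comp := fun i j k g f => eq_trans f g |}.
- intros i j f; apply proof_irrelevance.
- intros i j f; apply proof_irrelevance.
- intros i j k l h g f; apply proof_irrelevance.
Defined.

Definition family_functor (I : Type) (C : Category) (X : I -> C) :
  Functor (discrete_category I) C.
Proof.
refine (@Build_Functor (discrete_category I) C X
  (fun i j (E : i = j) =>
     match E in _ = k return hom (X i) (X k) with eq_refl => idm (X i) end) _ _).
- reflexivity.
- intros i j k g f; destruct g, f; simpl; now rewrite comp_idl.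
Defined.

Lemma finite_products (C : Category) (I : Type) (X : I -> C) :
  finitely_complete C -> (exists l : list I, forall i, In i l) ->
  exists (x : C) (p : forall i, hom x (X i)),
    forall y (q : forall i, hom y (X i)), exists! h, forall i, p i ∘ h = q i.
Proof.
intros HC HI.
destruct (HC _ (family_functor X)) as [x [p [_ Hp]]].
- split; [exact HI|]. intros i j. simpl in *.
  destruct (excluded_middle_informative (i = j)) as [E|E].
  + exists (E :: nil). intros f. left. apply proof_irrelevance.
  + exists nil. intros f. contradiction.
- exists x, p. intros y q. apply Hp.
  intros i j f. simpl in f. destruct f. apply comp_idl.
Qed.

Definition parallel_pair : Category.
Proof.
unshelve refine {| ob := bool;
  hom := fun i j => if i then (if j then unit else Empty_set)
                    else (if j then bool else unit) |}.
- intros [|]; exact tt.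
- intros [|] [|] [|] g f;
    solve [exact f | exact g | destruct f | destruct g].
- intros [|] [|] f; try destruct f; reflexivity.
- intros [|] [|] f; try destruct f; reflexivity.
- intros [|] [|] [|] [|] h g f; try destruct h; try destruct g; try destruct f;
    reflexivity.
Defined.

Lemma parallel_pair_finite : finite_category parallel_pair.
Proof.
split.
- exists (true :: false :: nil). intros [|]; simpl; auto.
- intros [|] [|].
  + exists (tt :: nil). intros []; simpl; auto.
  + exists nil. intros [].
  + exists (true :: false :: nil). intros [|]; simpl; auto.
  + exists (tt :: nil). intros []; simpl; auto.
Qed.

Definition pair_functor (C : Category) (a b : C) (u v : hom a b) :
  Functor parallel_pair C.
Proof.
unshelve refine (@Build_Functor parallel_pair C (fun i => if i then b else a) _ _ _).
- intros [|] [|] f; [exact (idm b) | destruct f | exact (if f then u else v) |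
    exact (idm a)].
- intros [|]; reflexivity.
- intros [|] [|] [|] g f; try destruct g; try destruct f; simpl;
    rewrite ?comp_idl, ?comp_idr; reflexivity.
Defined.

Definition is_product (C : Category) (a b p : C) (p1 : hom p a) (p2 : hom p b) : Prop :=
  forall x (u : hom x a) (v : hom x b), exists! w, p1 ∘ w = u /\ p2 ∘ w = v.

Definition is_terminal (C : Category) (z : C) : Prop :=
  forall x, exists! f : hom x z, True.

Definition is_equalizer (C : Category) (e a b : C) (u v : hom a b) (i : hom e a) : Prop :=
  u ∘ i = v ∘ i /\ forall x (g : hom x a), u ∘ g = v ∘ g -> exists! h, i ∘ h = g.

Definition has_pullbacks (C : Category) : Prop :=
  forall (a b z : C) (f : hom a z) (g : hom b z),
    exists (p : C) (p1 : hom p a) (p2 : hom p b), is_pullback f g p1 p2.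

Definition has_products (C : Category) : Prop :=
  forall a b : C, exists (p : C) (p1 : hom p a) (p2 : hom p b), is_product p1 p2.

Lemma pullback_lift (C : Category) (a b z p : C) (f : hom a z) (g : hom b z)
    (p1 : hom p a) (p2 : hom p b) (H : is_pullback f g p1 p2)
    x (u : hom x a) (v : hom x b) :
  f ∘ u = g ∘ v -> exists w, p1 ∘ w = u /\ p2 ∘ w = v.
Proof. intros E. destruct (proj2 H _ _ _ E) as [w [Hw _]]. eauto. Qed.

Lemma pullback_jointly_monic (C : Category) (a b z p : C) (f : hom a z) (g : hom b z)
    (p1 : hom p a) (p2 : hom p b) : is_pullback f g p1 p2 -> jointly_monic p1 p2.
Proof.
intros [E H] x u v E1 E2.
destruct (H x (p1 ∘ u) (p2 ∘ u)) as [w [_ Hw]].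
- now rewrite !comp_assoc, E.
- transitivity w; [symmetry|]; apply Hw; auto.
Qed.

Lemma pullback_intro (C : Category) (a b z p : C) (f : hom a z) (g : hom b z)
    (p1 : hom p a) (p2 : hom p b) :
  f ∘ p1 = g ∘ p2 -> jointly_monic p1 p2 ->
  (forall x (u : hom x a) (v : hom x b), f ∘ u = g ∘ v ->
     exists w, p1 ∘ w = u /\ p2 ∘ w = v) ->
  is_pullback f g p1 p2.
Proof.
intros E J H; split; [exact E|].
intros x u v Euv. destruct (H x u v Euv) as [w [H1 H2]].
exists w; split; [now split|].
intros w' [H1' H2']. apply J; congruence.
Qed.

Lemma product_pair (C : Category) (a b p : C) (p1 : hom p a) (p2 : hom p b)
    (H : is_product p1 p2) x (u : hom x a) (v : hom x b) :
  exists w, p1 ∘ w = u /\ p2 ∘ w = v.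
Proof. destruct (H _ u v) as [w [Hw _]]. eauto. Qed.

Lemma product_jointly_monic (C : Category) (a b p : C) (p1 : hom p a) (p2 : hom p b) :
  is_product p1 p2 -> jointly_monic p1 p2.
Proof.
intros H x u v E1 E2. destruct (H x (p1 ∘ u) (p2 ∘ u)) as [w [_ Hw]].
transitivity w; [symmetry|]; apply Hw; auto.
Qed.

Lemma pullback_over_terminal (C : Category) (a b z p : C) (f : hom a z) (g : hom b z)
    (p1 : hom p a) (p2 : hom p b) :
  is_terminal z -> is_pullback f g p1 p2 -> is_product p1 p2.
Proof.
intros Hz H x u v. apply (proj2 H).
destruct (Hz x) as [t [_ Ht]]. now rewrite <- (Ht (f ∘ u)), <- (Ht (g ∘ v)).
Qed.

Section Limits.
Variable C : Category.

Lemma binary_products : finitely_complete C -> has_products C.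
Proof.
intros HC a b.
destruct (@finite_products C bool (fun i => if i then a else b) HC) as [x [p Hp]].
- exists (true :: false :: nil). intros [|]; simpl; auto.
- exists x, (p true), (p false). intros y u v.
  destruct (Hp y (fun i => match i return hom y (if i then a else b) with
                           | true => u | false => v end)) as [h [Hh Hu]].
  exists h; split.
  + exact (conj (Hh true) (Hh false)).
  + intros h' [H1 H2]. apply Hu. now intros [|].
Qed.

Lemma terminal_object : finitely_complete C -> exists z : C, is_terminal z.
Proof.
intros HC.
destruct (@finite_products C Empty_set (fun i => match i with end) HC) as [x [p Hp]].
- exists nil. intros [].
- exists x. intros y.
  destruct (Hp y (fun i => match i with end)) as [h [_ Hu]].
  exists h; split; [exact I|]. intros h' _. apply Hu. intros [].
Qed.

Lemma equalizers : finitely_complete C ->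
  forall (a b : C) (u v : hom a b), exists (e : C) (i : hom e a), is_equalizer u v i.
Proof.
intros HC a b u v.
destruct (HC _ (pair_functor u v) parallel_pair_finite) as [e [p [Hc Hp]]].
assert (Eu : u ∘ p false = p true) by exact (Hc false true true).
assert (Ev : v ∘ p false = p true) by exact (Hc false true false).
exists e, (p false); split; [exact (eq_trans Eu (eq_sym Ev))|].
intros x g E.
destruct (Hp x (fun i => match i return hom x (pair_functor u v i) with
                         | true => u ∘ g | false => g end)) as [h [Hh Hu]].
- intros [|] [|] f; try destruct f; simpl; rewrite ?comp_idl; auto.
- exists h; split; [exact (Hh false)|].
  intros h' E'. apply Hu. intros [|]; [|exact E'].
  transitivity (u ∘ p false ∘ h'); [now rewrite Eu|].
  rewrite <- comp_assoc. now f_equal.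
Qed.

Lemma pullbacks : finitely_complete C -> has_pullbacks C.
Proof.
intros HC a b z f g.
destruct (binary_products HC a b) as [p [p1 [p2 Hp]]].
destruct (equalizers HC (f ∘ p1) (g ∘ p2)) as [e [i [Ei Hi]]].
exists e, (p1 ∘ i), (p2 ∘ i). apply pullback_intro.
- now rewrite !comp_assoc.
- intros x u v E1 E2.
  assert (E : i ∘ u = i ∘ v)
    by (apply (product_jointly_monic Hp); rewrite !comp_assoc; auto).
  destruct (Hi x (i ∘ u)) as [w [_ Hw]].
  + now rewrite !comp_assoc, Ei.
  + transitivity w; [symmetry|]; apply Hw; auto.
- intros x u v E. destruct (product_pair Hp u v) as [w [H1 H2]].
  destruct (Hi x w) as [h [Hh _]].
  + now rewrite <- !comp_assoc, H1, H2.
  + exists h. now rewrite <- !comp_assoc, Hh.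
Qed.

Lemma coequalizers : finitely_cocomplete C ->
  forall (a b : C) (u v : hom a b), exists (q : C) (r : hom b q), is_coequalizer u v r.
Proof.
intros HC a b u v.
destruct (HC _ (pair_functor u v) parallel_pair_finite) as [q [p [Hc Hp]]].
assert (Eu : p true ∘ u = p false) by exact (Hc false true true).
assert (Ev : p true ∘ v = p false) by exact (Hc false true false).
exists q, (p true); split; [exact (eq_trans Eu (eq_sym Ev))|].
intros x g E.
destruct (Hp x (fun i => match i return hom (pair_functor u v i) x with
                         | true => g | false => g ∘ u end)) as [h [Hh Hu]].
- intros [|] [|] f; try destruct f; simpl; rewrite ?comp_idr; auto.
- exists h; split; [exact (Hh true)|].
  intros h' E'. apply Hu. intros [|]; [exact E'|].
  transitivity (h' ∘ (p true ∘ u)); [now rewrite Eu|].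
  rewrite comp_assoc. now f_equal.
Qed.

End Limits.

(** * Epimorphisms in regular categories *)

Definition epic (C : Category) (a b : C) (f : hom a b) : Prop :=
  forall x (u v : hom b x), u ∘ f = v ∘ f -> u = v.

(** In a category with pullbacks these are the regular epimorphisms.  This form quantifies
    over all pairs that [f] coequalizes, instead of choosing one. *)
Definition strict_epi (C : Category) (a b : C) (f : hom a b) : Prop :=
  epic f /\
  forall x (g : hom a x),
    (forall t (u v : hom t a), f ∘ u = f ∘ v -> g ∘ u = g ∘ v) ->
    exists h : hom b x, h ∘ f = g.

Lemma coequalizer_strict_epi (C : Category) (k a b : C) (k1 k2 : hom k a) (f : hom a b) :
  is_coequalizer k1 k2 f -> strict_epi f.
Proof.
intros [E H]; split.
- intros x u v Euv. destruct (H x (u ∘ f)) as [w [_ Hw]].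
  + now rewrite <- !comp_assoc, E.
  + transitivity w; [symmetry|]; apply Hw; auto.
- intros x g Hg. destruct (H x g (Hg _ _ _ E)) as [h [Hh _]]. eauto.
Qed.

Lemma regular_epi_strict (C : Category) (a b : C) (f : hom a b) :
  regular_epi f -> strict_epi f.
Proof. intros [k [k1 [k2 H]]]. exact (coequalizer_strict_epi H). Qed.

Lemma strict_epi_regular (C : Category) (HP : has_pullbacks C) (a b : C) (f : hom a b) :
  strict_epi f -> regular_epi f.
Proof.
intros [He Hf]. destruct (HP _ _ _ f f) as [k [k1 [k2 Hk]]].
exists k, k1, k2; split; [exact (proj1 Hk)|].
intros x g E. destruct (Hf x g) as [h Hh].
- intros t u v Euv. destruct (pullback_lift Hk Euv) as [w [<- <-]].
  now rewrite !comp_assoc, E.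
- exists h; split; [exact Hh|]. intros h' Hh'. apply He; congruence.
Qed.

(** Any morphism [g] compatible with [q ∘ d] identifies x with e (d x), so that
    [g = g ∘ e ∘ d]. *)
Lemma strict_epi_after_split (C : Category) (a b c : C) (d : hom a b) (e : hom b a)
    (q : hom b c) : d ∘ e = idm b -> strict_epi q -> strict_epi (q ∘ d).
Proof.
intros Ede [He Hq]; split.
- intros x u v E. apply He.
  rewrite <- (comp_idr (u ∘ q)), <- (comp_idr (v ∘ q)), <- Ede, !comp_assoc.
  rewrite comp_assoc in E. rewrite comp_assoc in E. now rewrite E.
- intros x g Hg. destruct (Hq x (g ∘ e)) as [h Hh].
  + intros t u v E. cnorm. apply Hg. now crw Ede.
  + exists h. rewrite comp_assoc, Hh. cnorm.
    rewrite <- (comp_idr g) at 2. apply Hg. now crw Ede.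
Qed.

Definition is_strict_pushout (C : Category) (a b p s : C) (f : hom a b) (q : hom a p)
    (r : hom b s) (n : hom p s) : Prop :=
  strict_epi r /\ r ∘ f = n ∘ q /\
  forall x (u : hom b x) (v : hom p x), u ∘ f = v ∘ q ->
    exists h : hom s x, h ∘ r = u /\ h ∘ n = v.

(** If [q] is the coequalizer of k1 and k2, then [r] is the coequalizer of [f ∘ k1] and
    [f ∘ k2]. *)
Lemma pushout_of_strict_epi (C : Category) (HC : finitely_cocomplete C)
    (HP : has_pullbacks C) (a b p : C) (f : hom a b) (q : hom a p) :
  strict_epi q ->
  exists (s : C) (r : hom b s) (n : hom p s), is_strict_pushout f q r n.
Proof.
intros Hq.
destruct (strict_epi_regular HP Hq) as [k [k1 [k2 [Ek Hk]]]].
destruct (coequalizers HC (f ∘ k1) (f ∘ k2)) as [s [r Hr]].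
destruct (Hk s (r ∘ f)) as [n [Hn _]].
{ rewrite <- !comp_assoc. apply Hr. }
exists s, r, n; split; [exact (coequalizer_strict_epi Hr)|split; [auto|]].
- intros x u v E.
  destruct (proj2 Hr x u) as [h [Hh _]].
  { rewrite !comp_assoc, E. cnorm. now rewrite Ek. }
  exists h; split; [exact Hh|].
  apply (proj1 Hq). now rewrite <- comp_assoc, Hn, comp_assoc, Hh.
Qed.

Lemma image_factorization (C : Category) (HC : regular_category C) (a b : C)
    (f : hom a b) :
  exists (m : C) (r : hom a m) (i : hom m b), strict_epi r /\ monic i /\ i ∘ r = f.
Proof.
pose proof (pullbacks (regular_complete HC)) as HP.
destruct (HP _ _ _ f f) as [k [k1 [k2 Hk]]].
destruct (regular_coequalizers HC Hk) as [m [r Hr]].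
assert (Rr : regular_epi r) by (exists k, k1, k2; exact Hr).
destruct (proj2 Hr _ f (proj1 Hk)) as [i [Hi _]].
exists m, r, i; split; [now apply regular_epi_strict|split; [|exact Hi]].
intros t u v E.
(* [t'] covers [t] and carries liftings of both [u] and [v] along [r]. *)
destruct (HP _ _ _ r u) as [s [s1 [s2 Hs]]].
destruct (HP _ _ _ r (v ∘ s2)) as [t' [t1 [t2 Ht]]].
destruct (regular_epi_strict (regular_stable HC Hs Rr)) as [Es _].
destruct (regular_epi_strict (regular_stable HC Ht Rr)) as [Et _].
apply Es, Et.
destruct (pullback_lift Hk (u := s1 ∘ t2) (v := t1)) as [w [W1 W2]].
- rewrite <- Hi. cnorm. crw (proj1 Hs). rewrite (proj1 Ht). cnorm.
  crw E. reflexivity.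
- transitivity (r ∘ t1); [|exact (proj1 Ht)].
  rewrite <- W2. crw <- (proj1 Hr). rewrite W1. now crw (proj1 Hs).
Qed.

(** * Mal'tsev categories *)

(** The triples (a, b, c) of related pairs a = (x, y), b = (x', y') and c = (x, y') are
    the elements of a reflexive relation on [r] between a and b.  Its symmetry provides the
    related pair (x', y). *)
Lemma maltsev_difunctional (C : Category) (HM : maltsev_category C) (r x y : C)
    (r1 : hom r x) (r2 : hom r y) :
  jointly_monic r1 r2 ->
  forall t (a b c : hom t r), r1 ∘ c = r1 ∘ a -> r2 ∘ c = r2 ∘ b ->
    exists c' : hom t r, r1 ∘ c' = r1 ∘ b /\ r2 ∘ c' = r2 ∘ a.
Proof.
intros J t a b c Ea Eb.
pose proof (pullbacks (maltsev_complete HM)) as HP.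
(* [s] is the object of triples. *)
destruct (HP _ _ _ r1 r1) as [k [k1 [k2 Hk]]].
destruct (HP _ _ _ r2 r2) as [l [l1 [l2 Hl]]].
destruct (HP _ _ _ k1 l1) as [s [s1 [s2 Hs]]].
assert (Lift : forall t (a b c : hom t r), r1 ∘ c = r1 ∘ a -> r2 ∘ c = r2 ∘ b ->
  exists w, k2 ∘ s1 ∘ w = a /\ l2 ∘ s2 ∘ w = b).
{ clear - Hk Hl Hs. intros t a b c Ea Eb.
  destruct (pullback_lift Hk Ea) as [u [U1 U2]].
  destruct (pullback_lift Hl Eb) as [v [V1 V2]].
  destruct (pullback_lift Hs (u := u) (v := v)) as [w [W1 W2]]; [congruence|].
  exists w. cnorm. now rewrite W1, W2. }
assert (Rel : is_relation (k2 ∘ s1) (l2 ∘ s2)).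
{ intros z u v E1 E2. rewrite <- !comp_assoc in E1, E2.
  assert (E : k1 ∘ s1 ∘ u = k1 ∘ s1 ∘ v).
  { apply J.
    - cnorm. crw (proj1 Hk). now rewrite E1.
    - rewrite (proj1 Hs). cnorm. crw (proj1 Hl). now rewrite E2. }
  apply (pullback_jointly_monic Hs).
  - apply (pullback_jointly_monic Hk); [now rewrite !comp_assoc | exact E1].
  - apply (pullback_jointly_monic Hl); [| exact E2].
    now rewrite !comp_assoc, <- (proj1 Hs). }
assert (Refl : reflexive_rel (k2 ∘ s1) (l2 ∘ s2)).
{ destruct (Lift _ (idm r) (idm r) (idm r) eq_refl eq_refl) as [w Hw].
  now exists w. }
destruct (maltsev_equivalence HM Rel Refl) as [_ [_ [[o [O1 O2]] _]]].
destruct (Lift _ a b c Ea Eb) as [w [W1 W2]].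
exists (k1 ∘ s1 ∘ o ∘ w); split.
- crw (proj1 Hk). crw (eq_trans (comp_assoc _ _ _) O1).
  now rewrite <- W2, !comp_assoc.
- rewrite (proj1 Hs). crw (proj1 Hl).
  crw (eq_trans (comp_assoc _ _ _) O2).
  now rewrite <- W1, !comp_assoc.
Qed.

Section SplitPullback.
Variables (C : Category) (HM : maltsev_category C).
Variables (x y b r : C) (p : hom x b) (q : hom y b) (s : hom b x) (t : hom b y).
Variables (r1 : hom r x) (r2 : hom r y).
Hypotheses (Eps : p ∘ s = idm b) (Eqt : q ∘ t = idm b) (Hr : is_pullback p q r1 r2).

(** Write 1 for the values of the sections.  Since (x, 1), (1, 1) and (1, y) lie in [m],
    so does (x, y), by difunctionality. *)
Lemma subobject_containing_sections (m : C) (i : hom m r) (f : hom x m) (g : hom y m) :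
  monic i ->
  r1 ∘ i ∘ f = idm x -> r2 ∘ i ∘ f = t ∘ p ->
  r1 ∘ i ∘ g = s ∘ q -> r2 ∘ i ∘ g = idm y ->
  exists k : hom r m, i ∘ k = idm r.
Proof.
intros Hi F1 F2 G1 G2.
assert (J : jointly_monic (r1 ∘ i) (r2 ∘ i)).
{ intros z u v E1 E2. apply Hi, (pullback_jointly_monic Hr);
    now rewrite !comp_assoc. }
destruct (@maltsev_difunctional C HM _ _ _ _ _ J r (g ∘ r2) (f ∘ r1) (g ∘ t ∘ p ∘ r1))
  as [k [K1 K2]].
- rewrite !comp_assoc, G1. crw Eqt. crw (proj1 Hr). reflexivity.
- rewrite !comp_assoc, F2, G2. now cnorm.
- rewrite !comp_assoc, F1 in K1. rewrite !comp_assoc, G2 in K2.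
  exists k. apply (pullback_jointly_monic Hr); rewrite comp_idr, comp_assoc.
  + now rewrite K1, comp_idl.
  + now rewrite K2, comp_idl.
Qed.

(** The equalizer of [u] and [v] contains both sections. *)
Lemma sections_jointly_epic (z : C) (u v : hom r z) :
  (forall w, r1 ∘ w = idm x -> r2 ∘ w = t ∘ p -> u ∘ w = v ∘ w) ->
  (forall w, r1 ∘ w = s ∘ q -> r2 ∘ w = idm y -> u ∘ w = v ∘ w) ->
  u = v.
Proof.
intros H1 H2.
destruct (equalizers (maltsev_complete HM) u v) as [m [i [Ei Hi]]].
destruct (pullback_lift Hr (u := idm x) (v := t ∘ p)) as [f0 [F1 F2]].
{ rewrite comp_assoc, Eqt. now cnorm. }
destruct (pullback_lift Hr (u := s ∘ q) (v := idm y)) as [g0 [G1 G2]].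
{ rewrite comp_assoc, Eps. now cnorm. }
destruct (Hi _ f0 (H1 _ F1 F2)) as [f [Ef _]].
destruct (Hi _ g0 (H2 _ G1 G2)) as [g [Eg _]].
destruct (@subobject_containing_sections m i f g) as [k Hk];
  rewrite <- ?comp_assoc, ?Ef, ?Eg; auto.
- intros z' a a' E. destruct (Hi _ (i ∘ a)) as [w [_ Hw]].
  + now rewrite !comp_assoc, Ei.
  + transitivity w; [symmetry|]; apply Hw; auto.
- rewrite <- (comp_idr u), <- (comp_idr v), <- Hk, !comp_assoc. now rewrite Ei.
Qed.

End SplitPullback.

(** * Groupoid structures on a reflexive graph *)

(** Internal groupoids with the underlying graph as a parameter, so that the horizontal and
    vertical groupoids of a double groupoid can share their objects and arrows
    definitionally. *)
Record groupoid_structure (C : Category) (x0 x1 : C) (d c : hom x1 x0) (e : hom x0 x1) := {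
  gs_pairs : C;
  gs_fst : hom gs_pairs x1;
  gs_snd : hom gs_pairs x1;
  gs_comp : hom gs_pairs x1;
  gs_inv : hom x1 x1;
  gs_pullback : is_pullback d c gs_fst gs_snd;
  gs_dom_unit : d ∘ e = idm x0;
  gs_cod_unit : c ∘ e = idm x0;
  gs_dom_comp : d ∘ gs_comp = d ∘ gs_snd;
  gs_cod_comp : c ∘ gs_comp = c ∘ gs_fst;
  gs_comp_unit_r : forall w : hom x1 gs_pairs,
    gs_fst ∘ w = idm x1 -> gs_snd ∘ w = e ∘ d -> gs_comp ∘ w = idm x1;
  gs_comp_unit_l : forall w : hom x1 gs_pairs,
    gs_fst ∘ w = e ∘ c -> gs_snd ∘ w = idm x1 -> gs_comp ∘ w = idm x1;
  gs_comp_assoc : forall (t : C) (hg gf l r : hom t gs_pairs),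
    gs_snd ∘ hg = gs_fst ∘ gf ->
    gs_fst ∘ l = gs_comp ∘ hg -> gs_snd ∘ l = gs_snd ∘ gf ->
    gs_fst ∘ r = gs_fst ∘ hg -> gs_snd ∘ r = gs_comp ∘ gf ->
    gs_comp ∘ l = gs_comp ∘ r;
  gs_dom_inv : d ∘ gs_inv = c;
  gs_cod_inv : c ∘ gs_inv = d;
  gs_comp_inv_l : forall w : hom x1 gs_pairs,
    gs_fst ∘ w = gs_inv -> gs_snd ∘ w = idm x1 -> gs_comp ∘ w = e ∘ d;
  gs_comp_inv_r : forall w : hom x1 gs_pairs,
    gs_fst ∘ w = idm x1 -> gs_snd ∘ w = gs_inv -> gs_comp ∘ w = e ∘ c
}.

Definition groupoid_of (C : Category) (x0 x1 : C) (d c : hom x1 x0) (e : hom x0 x1)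
    (s : groupoid_structure d c e) : Groupoid C := {|
  gr_pullback := gs_pullback s;
  gr_dom_unit := gs_dom_unit s;
  gr_cod_unit := gs_cod_unit s;
  gr_dom_comp := gs_dom_comp s;
  gr_cod_comp := gs_cod_comp s;
  gr_comp_unit_r := gs_comp_unit_r (g := s);
  gr_comp_unit_l := gs_comp_unit_l (g := s);
  gr_comp_assoc := gs_comp_assoc (g := s);
  gr_dom_inv := gs_dom_inv s;
  gr_cod_inv := gs_cod_inv s;
  gr_comp_inv_l := gs_comp_inv_l (g := s);
  gr_comp_inv_r := gs_comp_inv_r (g := s)
|}.

Section MultiplicativeGraph.
Variables (C : Category) (HM : maltsev_category C).
Variables (x0 x1 : C) (d c : hom x1 x0) (e : hom x0 x1).
Hypotheses (Hd : d ∘ e = idm x0) (Hc : c ∘ e = idm x0).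
Variables (P : C) (fst snd : hom P x1).
Hypothesis HP : is_pullback d c fst snd.
Variable m : hom P x1.
Hypothesis unit_r : forall w : hom x1 P,
  fst ∘ w = idm x1 -> snd ∘ w = e ∘ d -> m ∘ w = idm x1.
Hypothesis unit_l : forall w : hom x1 P,
  fst ∘ w = e ∘ c -> snd ∘ w = idm x1 -> m ∘ w = idm x1.

Let pair (t : C) (g f : hom t x1) (E : d ∘ g = c ∘ f) :
  exists w, fst ∘ w = g /\ snd ∘ w = f := pullback_lift HP E.

Let joint : jointly_monic fst snd := pullback_jointly_monic HP.

Lemma mult_unit_r (t : C) (w : hom t P) :
  snd ∘ w = e ∘ d ∘ (fst ∘ w) -> m ∘ w = fst ∘ w.
Proof.
intros E. destruct (@pair _ (idm x1) (e ∘ d)) as [v [V1 V2]].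
{ rewrite comp_assoc, Hc. now cnorm. }
assert (Ew : w = v ∘ (fst ∘ w)).
{ apply joint; rewrite comp_assoc, ?V1, ?V2; [now cnorm | exact E]. }
rewrite Ew at 1. rewrite comp_assoc, (unit_r V1 V2). now cnorm.
Qed.

Lemma mult_unit_l (t : C) (w : hom t P) :
  fst ∘ w = e ∘ c ∘ (snd ∘ w) -> m ∘ w = snd ∘ w.
Proof.
intros E. destruct (@pair _ (e ∘ c) (idm x1)) as [v [V1 V2]].
{ rewrite comp_assoc, Hd. now cnorm. }
assert (Ew : w = v ∘ (snd ∘ w)).
{ apply joint; rewrite comp_assoc, ?V1, ?V2; [exact E | now cnorm]. }
rewrite Ew at 1. rewrite comp_assoc, (unit_l V1 V2). now cnorm.
Qed.

(** As for the codomain and for associativity below, it is enough to compare the two sides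
    on the pairs (g, 1) and (1, f), where the unit laws compute the composite. *)
Lemma mult_dom : d ∘ m = d ∘ snd.
Proof.
apply (sections_jointly_epic HM Hd Hc HP); intros w W1 W2; cnorm; rewrite W2.
- rewrite (unit_r W1 W2). crw Hd. reflexivity.
- now rewrite (unit_l W1 W2).
Qed.

Lemma mult_cod : c ∘ m = c ∘ fst.
Proof.
apply (sections_jointly_epic HM Hd Hc HP); intros w W1 W2; cnorm; rewrite W1.
- now rewrite (unit_r W1 W2).
- rewrite (unit_l W1 W2). crw Hc. reflexivity.
Qed.

(** The arrows h g and f range over the pullback of dom g and cod f, both of
    which are split, and associativity is clear when f is an identity or when
    g and h are. *)
Lemma mult_assoc (t : C) (hg gf l r : hom t P) :
  snd ∘ hg = fst ∘ gf ->
  fst ∘ l = m ∘ hg -> snd ∘ l = snd ∘ gf ->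
  fst ∘ r = fst ∘ hg -> snd ∘ r = m ∘ gf -> m ∘ l = m ∘ r.
Proof.
intros E L1 L2 R1 R2.
destruct (@pair _ e e) as [ee [EE1 EE2]]; [congruence|].
assert (EEm : m ∘ ee = e).
{ rewrite mult_unit_l; [exact EE2|]. rewrite EE1, EE2. crw Hc. reflexivity. }
destruct (pullbacks (maltsev_complete HM) (d ∘ snd) c) as [T [t1 [t2 HT]]].
assert (ET : d ∘ m ∘ t1 = c ∘ t2) by (rewrite mult_dom; apply HT).
destruct (@pair _ (m ∘ t1) t2) as [l0 [L01 L02]]; [now rewrite comp_assoc|].
destruct (@pair _ (snd ∘ t1) t2) as [gf0 [GF1 GF2]].
{ rewrite comp_assoc. apply HT. }
destruct (@pair _ (fst ∘ t1) (m ∘ gf0)) as [r0 [R01 R02]].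
{ crw (proj1 HP). crw mult_cod. now rewrite GF1. }
assert (K : m ∘ l0 = m ∘ r0).
{ apply (@sections_jointly_epic C HM _ _ _ _ (d ∘ snd) c ee e t1 t2).
  - rewrite <- comp_assoc, EE2. exact Hd.
  - exact Hc.
  - exact HT.
  - intros w W1 W2. cnorm. transitivity m.
    + rewrite mult_unit_r.
      * crw L01. rewrite W1. now cnorm.
      * crw L02. rewrite W2. crw L01. rewrite W1. cnorm. now crw mult_dom.
    + rewrite <- (comp_idr m) at 1. f_equal. symmetry.
      apply joint.
      * crw R01. rewrite W1. now cnorm.
      * crw R02. rewrite mult_unit_r.
        -- crw GF1. rewrite W1. now cnorm.
        -- crw GF2. rewrite W2. crw GF1. rewrite W1. now cnorm.
  - intros w W1 W2. cnorm. rewrite !mult_unit_l.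
    + crw L02. crw R02. rewrite mult_unit_l.
      * now crw GF2.
      * crw GF1. rewrite W1. crw GF2. rewrite W2. crw EE2. reflexivity.
    + crw R01. rewrite W1. crw R02. rewrite mult_unit_l.
      * crw GF2. rewrite W2. crw EE1. reflexivity.
      * crw GF1. rewrite W1. crw GF2. rewrite W2. crw EE2. reflexivity.
    + crw L01. rewrite W1. crw L02. rewrite W2. cnorm.
      now crw EEm. }
destruct (pullback_lift HT (u := hg) (v := snd ∘ gf)) as [w [W1 W2]].
{ crw E. now crw (proj1 HP). }
assert (El : l = l0 ∘ w).
{ apply joint.
  - crw L01. now rewrite W1.
  - crw L02. now rewrite W2. }
assert (Egf : gf = gf0 ∘ w).
{ apply joint.
  - crw GF1. now rewrite W1, E.
  - crw GF2. now rewrite W2. }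
assert (Er : r = r0 ∘ w).
{ apply joint.
  - crw R01. now rewrite W1.
  - crw R02. now rewrite <- Egf. }
rewrite El, Er, !comp_assoc. now rewrite K.
Qed.

(** Let (g, g') be related to f when g f = g' f.  If (g, g') is related to f, then it is
    also related to 1, because (1, 1) is related to both f and 1; and this means that
    g = g'. *)
Lemma mult_cancel : jointly_monic m snd.
Proof.
intros t u v Em Es.
destruct (binary_products (maltsev_complete HM) x1 x1) as [X [p1 [p2 HX]]].
destruct (binary_products (maltsev_complete HM) x1 x1) as [Y [q1 [q2 HY]]].
destruct (product_pair HY m snd) as [ms [M1 M2]].
destruct (pullbacks (maltsev_complete HM) ms ms) as [K [k1 [k2 HK]]].
assert (Km : m ∘ k1 = m ∘ k2) by (rewrite <- M1; crw (proj1 HK); reflexivity).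
assert (Ks : snd ∘ k1 = snd ∘ k2) by (rewrite <- M2; crw (proj1 HK); reflexivity).
assert (Lift : forall t (a b : hom t P), m ∘ a = m ∘ b -> snd ∘ a = snd ∘ b ->
          exists w, k1 ∘ w = a /\ k2 ∘ w = b).
{ intros z a b Ea Eb. apply (pullback_lift HK).
  apply (product_jointly_monic HY).
  - now crw M1.
  - now crw M2. }
(* The relation: [g] is the pair (g, g') and [snd ∘ k1] is f. *)
destruct (product_pair HX (fst ∘ k1) (fst ∘ k2)) as [g [G1 G2]].
assert (J : jointly_monic g (snd ∘ k1)).
{ intros z a b Ea Eb. rewrite <- !comp_assoc in Eb.
  apply (pullback_jointly_monic HK); apply joint.
  - rewrite !comp_assoc, <- G1. cnorm. now rewrite Ea.
  - exact Eb.
  - rewrite !comp_assoc, <- G2. cnorm. now rewrite Ea.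
  - rewrite !comp_assoc, <- Ks. now cnorm. }
destruct (Lift _ u v Em Es) as [b [B1 B2]].
destruct (@pair _ (e ∘ c ∘ (snd ∘ u)) (snd ∘ u)) as [w [W1 W2]].
{ crw Hd. reflexivity. }
destruct (@pair _ (e ∘ c ∘ (snd ∘ u)) (e ∘ c ∘ (snd ∘ u))) as [w' [W1' W2']].
{ crw Hd. crw Hc. reflexivity. }
destruct (Lift _ w w eq_refl eq_refl) as [h [C1 C2]].
destruct (Lift _ w' w' eq_refl eq_refl) as [a [A1 A2]].
destruct (@maltsev_difunctional C HM _ _ _ _ _ J t a b h) as [k [H1 H2]].
- apply (product_jointly_monic HX).
  + crw G1. rewrite C1, A1. congruence.
  + crw G2. rewrite C2, A2. congruence.
- cnorm. now rewrite C1, B1.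
- assert (F1 : fst ∘ (k1 ∘ k) = fst ∘ u).
  { rewrite comp_assoc, <- G1. crw H1. crw G1. now rewrite B1. }
  assert (F2 : fst ∘ (k2 ∘ k) = fst ∘ v).
  { rewrite comp_assoc, <- G2. crw H1. crw G2. now rewrite B2. }
  rewrite <- comp_assoc in H2.
  assert (S1 : snd ∘ (k1 ∘ k) = e ∘ c ∘ (snd ∘ u)).
  { rewrite H2. cnorm. now rewrite A1, W2', <- comp_assoc. }
  assert (S2 : snd ∘ (k2 ∘ k) = e ∘ c ∘ (snd ∘ u)).
  { rewrite <- S1, !comp_assoc. now rewrite Ks. }
  apply joint; [|exact Es].
  rewrite <- F1, <- F2.
  rewrite <- (@mult_unit_r _ (k1 ∘ k)), <- (@mult_unit_r _ (k2 ∘ k)).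
  + rewrite !comp_assoc. now rewrite Km.
  + rewrite S2, F2. rewrite Es. crw <- (proj1 HP). reflexivity.
  + rewrite S1, F1. crw <- (proj1 HP). reflexivity.
Qed.

(** By [mult_cancel], the pairs (h, f) such that h = g f for some g form a relation.  It
    contains (1, 1), (f, 1) and (f, f), hence also (1, f), which gives the inverse
    of f. *)
Lemma mult_left_inverse :
  exists w : hom x1 P, snd ∘ w = idm x1 /\ m ∘ w = e ∘ d.
Proof.
destruct (@pair _ (e ∘ d) (e ∘ d)) as [b [B1 B2]].
{ crw Hd. crw Hc. reflexivity. }
destruct (@pair _ (e ∘ c) (idm x1)) as [a [A1 A2]].
{ crw Hd. reflexivity. }
destruct (@pair _ (idm x1) (e ∘ d)) as [w [W1 W2]].
{ crw Hc. reflexivity. }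
destruct (@maltsev_difunctional C HM _ _ _ _ _ mult_cancel x1 a b w) as [k [K1 K2]].
- now rewrite (unit_r W1 W2), (unit_l A1 A2).
- congruence.
- exists k; split; [congruence|]. rewrite K1, mult_unit_r; [exact B1|].
  rewrite B1, B2. crw Hd. reflexivity.
Qed.

(** The right inverse law follows from the left one by right cancellation, as
    (f i) f = f (i f) = f = 1 f for a left inverse i of f. *)
Lemma multiplicative_graph_groupoid : inhabited (groupoid_structure d c e).
Proof.
destruct mult_left_inverse as [k [K1 K2]].
assert (Di : d ∘ (fst ∘ k) = c) by (crw (proj1 HP); rewrite K1; now cnorm).
assert (Ci : c ∘ (fst ∘ k) = d)
  by (crw <- mult_cod; rewrite K2; crw Hc; reflexivity).
constructor. refine (@Build_groupoid_structure C x0 x1 d c e P fst snd m (fst ∘ k)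
  HP Hd Hc mult_dom mult_cod unit_r unit_l mult_assoc Di Ci _ _).
- intros w W1 W2. rewrite <- K2. f_equal. apply joint; congruence.
- intros w W1 W2.
  destruct (@pair _ (e ∘ c) (idm x1)) as [a [A1 A2]].
  { crw Hd. reflexivity. }
  destruct (@pair _ (m ∘ w) (idm x1)) as [l [L1 L2]].
  { crw mult_dom. rewrite W2. now rewrite Di; cnorm. }
  destruct (@pair _ (idm x1) (e ∘ d)) as [r [R1 R2]].
  { crw Hc. reflexivity. }
  assert (El : l = a).
  { apply mult_cancel; [|congruence].
    rewrite (unit_l A1 A2), <- (unit_r R1 R2).
    apply (@mult_assoc _ w k l r); congruence. }
  now rewrite <- L1, El.
Qed.

End MultiplicativeGraph.

(** * Internal functors *)

(** The pairs (g, 1) and (1, f) are jointly epimorphic among the composable pairs of any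
    groupoid.  This consequence of the Mal'tsev property makes graph morphisms functors, and
    it passes from a category to its category of groupoids more directly than the Mal'tsev
    property itself. *)
Definition pairs_generated (D : Category) : Prop :=
  forall (G : Groupoid D) (z : D) (u v : hom (gr_pairs G) z),
    (forall w, gr_fst G ∘ w = idm _ -> gr_snd G ∘ w = gr_unit G ∘ gr_dom G ->
       u ∘ w = v ∘ w) ->
    (forall w, gr_fst G ∘ w = gr_unit G ∘ gr_cod G -> gr_snd G ∘ w = idm _ ->
       u ∘ w = v ∘ w) ->
    u = v.

Lemma maltsev_pairs_generated (C : Category) :
  maltsev_category C -> pairs_generated C.
Proof.
intros HM G.
exact (sections_jointly_epic HM (gr_dom_unit G) (gr_cod_unit G) (gr_pullback G)).
Qed.

Section GraphMorphisms.
Variables (D : Category) (HD : pairs_generated D) (G H : Groupoid D).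
Variables (f0 : hom (gr_ob G) (gr_ob H)) (f1 : hom (gr_arr G) (gr_arr H)).
Hypotheses (Hd : gr_dom H ∘ f1 = f0 ∘ gr_dom G) (Hc : gr_cod H ∘ f1 = f0 ∘ gr_cod G)
  (He : f1 ∘ gr_unit G = gr_unit H ∘ f0).

Lemma graph_morphism_comp (w : hom (gr_pairs G) (gr_pairs H)) :
  gr_fst H ∘ w = f1 ∘ gr_fst G -> gr_snd H ∘ w = f1 ∘ gr_snd G ->
  f1 ∘ gr_comp G = gr_comp H ∘ w.
Proof.
intros W1 W2. apply HD; intros v V1 V2; cnorm.
- rewrite (gr_comp_unit_r V1 V2).
  rewrite (mult_unit_r (gr_cod_unit H) (gr_pullback H) (@gr_comp_unit_r _ H)).
  + crw W1. rewrite V1. now cnorm.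
  + crw W1. crw W2. rewrite V1, V2. crw Hd. now crw He.
- rewrite (gr_comp_unit_l V1 V2).
  rewrite (mult_unit_l (gr_dom_unit H) (gr_pullback H) (@gr_comp_unit_l _ H)).
  + crw W2. rewrite V2. now cnorm.
  + crw W1. crw W2. rewrite V1, V2. crw Hc. now crw He.
Qed.

Definition graph_functor : InternalFunctor G H := {|
  if_dom := Hd; if_cod := Hc; if_unit := He; if_comp := graph_morphism_comp |}.

End GraphMorphisms.

Lemma functor_pairs (D : Category) (G H : Groupoid D) (F : InternalFunctor G H) :
  exists w : hom (gr_pairs G) (gr_pairs H),
    gr_fst H ∘ w = if_arr F ∘ gr_fst G /\ gr_snd H ∘ w = if_arr F ∘ gr_snd G /\
    if_arr F ∘ gr_comp G = gr_comp H ∘ w.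
Proof.
destruct (pullback_lift (gr_pullback H) (u := if_arr F ∘ gr_fst G)
  (v := if_arr F ∘ gr_snd G)) as [w [W1 W2]].
- crw (if_dom F). crw (if_cod F). now rewrite (proj1 (gr_pullback G)).
- exists w; split; [|split]; auto. now apply if_comp.
Qed.

(** The images by [F] of f and its inverse compose to an identity, as do the image of f and
    its own inverse; the two inverses agree by right cancellation. *)
Lemma functor_inv (C : Category) (HM : maltsev_category C) (G H : Groupoid C)
    (F : InternalFunctor G H) : if_arr F ∘ gr_inv G = gr_inv H ∘ if_arr F.
Proof.
destruct (functor_pairs F) as [p [P1 [P2 P3]]].
destruct (pullback_lift (gr_pullback G) (u := gr_inv G) (v := idm _)) as [v [V1 V2]].
{ rewrite gr_dom_inv. now cnorm. }
destruct (pullback_lift (gr_pullback H) (u := gr_inv H) (v := idm _)) as [w [W1 W2]].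
{ rewrite gr_dom_inv. now cnorm. }
assert (E : p ∘ v = w ∘ if_arr F).
{ apply (mult_cancel HM (gr_dom_unit H) (gr_cod_unit H) (gr_pullback H)
    (@gr_comp_unit_r _ H)).
  - crw <- P3. rewrite (gr_comp_inv_l V1 V2).
    crw (gr_comp_inv_l W1 W2). crw (if_unit F). now crw (if_dom F).
  - crw P2. crw W2. rewrite V2. now cnorm. }
rewrite <- V1, <- W1. crw <- P1. now rewrite E.
Qed.

Definition ob_functor (C : Category) : Functor (Grpd C) C :=
  @Build_Functor (Grpd C) C (fun G => gr_ob (G : Groupoid C)) (fun G H F => if_ob F)
    (fun G => eq_refl) (fun G H K F' F => eq_refl).

Definition arr_functor (C : Category) : Functor (Grpd C) C :=
  @Build_Functor (Grpd C) C (fun G => gr_arr (G : Groupoid C)) (fun G H F => if_arr F)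
    (fun G => eq_refl) (fun G H K F' F => eq_refl).

Section FunctorSquares.
Variables (C : Category) (G H K L : Groupoid C).
Variables (f : InternalFunctor H L) (g : InternalFunctor G H)
  (h : InternalFunctor K L) (k : InternalFunctor G K).
Hypothesis E : internal_comp f g = internal_comp h k.

Lemma functor_square_ob : if_ob f ∘ if_ob g = if_ob h ∘ if_ob k.
Proof. exact (f_equal (fmap (ob_functor C)) E). Qed.

Lemma functor_square_arr : if_arr f ∘ if_arr g = if_arr h ∘ if_arr k.
Proof. exact (f_equal (fmap (arr_functor C)) E). Qed.

End FunctorSquares.

Lemma levelwise_epic (C : Category) (G H : Groupoid C) (F : InternalFunctor G H) :
  epic (if_ob F) -> epic (if_arr F) -> @epic (Grpd C) G H F.
Proof.
intros H0 H1 Z U V E. apply internal_functor_eq.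
- exact (H0 _ _ _ (functor_square_ob E)).
- exact (H1 _ _ _ (functor_square_arr E)).
Qed.

(** * Pullbacks of groupoids *)

Section PullbacksOfGroupoids.
Variables (C : Category) (HM : maltsev_category C).

Let HC : pairs_generated C := maltsev_pairs_generated HM.

Lemma levelwise_pullback (G H Z K : Groupoid C) (F : InternalFunctor G Z)
    (F' : InternalFunctor H Z) (A : InternalFunctor K G) (B : InternalFunctor K H) :
  is_pullback (if_ob F) (if_ob F') (if_ob A) (if_ob B) ->
  is_pullback (if_arr F) (if_arr F') (if_arr A) (if_arr B) ->
  @is_pullback (Grpd C) G H Z K F F' A B.
Proof.
intros P0 P1. apply pullback_intro.
- apply internal_functor_eq; [apply P0 | apply P1].
- intros T U V E1 E2. apply internal_functor_eq.
  + exact (pullback_jointly_monic P0 (f_equal (fmap (ob_functor C)) E1)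
      (f_equal (fmap (ob_functor C)) E2)).
  + exact (pullback_jointly_monic P1 (f_equal (fmap (arr_functor C)) E1)
      (f_equal (fmap (arr_functor C)) E2)).
- intros T U V E.
  assert (E0 : if_ob F ∘ if_ob U = if_ob F' ∘ if_ob V)
    by exact (f_equal (fmap (ob_functor C)) E).
  assert (E1 : if_arr F ∘ if_arr U = if_arr F' ∘ if_arr V)
    by exact (f_equal (fmap (arr_functor C)) E).
  destruct (pullback_lift P0 E0) as [w0 [U0 V0]].
  destruct (pullback_lift P1 E1) as [w1 [U1 V1]].
  unshelve eexists.
  { apply (@graph_functor C HC T K w0 w1); apply (pullback_jointly_monic P0) ||
      apply (pullback_jointly_monic P1).
    - crw <- (if_dom A). crw U0. crw U1. apply if_dom.
    - crw <- (if_dom B). crw V0. crw V1. apply if_dom.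
    - crw <- (if_cod A). crw U0. crw U1. apply if_cod.
    - crw <- (if_cod B). crw V0. crw V1. apply if_cod.
    - crw (if_unit A). crw U0. crw U1. apply if_unit.
    - crw (if_unit B). crw V0. crw V1. apply if_unit. }
  split; apply internal_functor_eq; assumption.
Qed.

(** Composition is componentwise, and [multiplicative_graph_groupoid] reduces the axioms to
    the unit laws. *)
Lemma pullback_of_groupoids (G H Z : Groupoid C) (F : InternalFunctor G Z)
    (F' : InternalFunctor H Z) (p0 p1 : C)
    (a0 : hom p0 (gr_ob G)) (b0 : hom p0 (gr_ob H))
    (a1 : hom p1 (gr_arr G)) (b1 : hom p1 (gr_arr H)) :
  is_pullback (if_ob F) (if_ob F') a0 b0 -> is_pullback (if_arr F) (if_arr F') a1 b1 ->
  exists (d c : hom p1 p0) (e : hom p0 p1) (s : groupoid_structure d c e)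
    (A : InternalFunctor (groupoid_of s) G) (B : InternalFunctor (groupoid_of s) H),
    if_ob A = a0 /\ if_arr A = a1 /\ if_ob B = b0 /\ if_arr B = b1 /\
    @is_pullback (Grpd C) G H Z (groupoid_of s) F F' A B.
Proof.
intros P0 P1.
pose proof (pullback_jointly_monic P0) as J0.
pose proof (pullback_jointly_monic P1) as J1.
destruct (pullback_lift P0 (u := gr_dom G ∘ a1) (v := gr_dom H ∘ b1)) as [d [Da Db]].
{ crw <- (if_dom F). crw <- (if_dom F'). now rewrite (proj1 P1). }
destruct (pullback_lift P0 (u := gr_cod G ∘ a1) (v := gr_cod H ∘ b1)) as [c [Ca Cb]].
{ crw <- (if_cod F). crw <- (if_cod F'). now rewrite (proj1 P1). }
destruct (pullback_lift P1 (u := gr_unit G ∘ a0) (v := gr_unit H ∘ b0)) as [e [Ea Eb]].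
{ crw (if_unit F). crw (if_unit F'). now rewrite (proj1 P0). }
destruct (pullbacks (maltsev_complete HM) d c) as [k [k1 [k2 HK]]].
destruct (pullback_lift (gr_pullback G) (u := a1 ∘ k1) (v := a1 ∘ k2)) as [g [G1 G2]].
{ crw <- Da. crw <- Ca. now rewrite (proj1 HK). }
destruct (pullback_lift (gr_pullback H) (u := b1 ∘ k1) (v := b1 ∘ k2)) as [h [H1 H2]].
{ crw <- Db. crw <- Cb. now rewrite (proj1 HK). }
destruct (functor_pairs F) as [w [W1 [W2 W3]]].
destruct (functor_pairs F') as [w' [W1' [W2' W3']]].
destruct (pullback_lift P1 (u := gr_comp G ∘ g) (v := gr_comp H ∘ h)) as [m [Ma Mb]].
{ crw W3. crw W3'. f_equal. apply (pullback_jointly_monic (gr_pullback Z)).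
  - crw W1. crw W1'. rewrite G1, H1. now crw (proj1 P1).
  - crw W2. crw W2'. rewrite G2, H2. now crw (proj1 P1). }
destruct (@multiplicative_graph_groupoid C HM p0 p1 d c e) with (P := k) (fst := k1)
  (snd := k2) (m := m) as [s].
- apply J0.
  + crw Da. crw Ea. crw (gr_dom_unit G). reflexivity.
  + crw Db. crw Eb. crw (gr_dom_unit H). reflexivity.
- apply J0.
  + crw Ca. crw Ea. crw (gr_cod_unit G). reflexivity.
  + crw Cb. crw Eb. crw (gr_cod_unit H). reflexivity.
- exact HK.
- intros v V1 V2. apply J1.
  + crw Ma. rewrite (mult_unit_r (gr_cod_unit G) (gr_pullback G) (@gr_comp_unit_r _ G)).
    * crw G1. rewrite V1. now cnorm.
    * crw G1. crw G2. rewrite V1, V2. crw Ea. now crw Da.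
  + crw Mb. rewrite (mult_unit_r (gr_cod_unit H) (gr_pullback H) (@gr_comp_unit_r _ H)).
    * crw H1. rewrite V1. now cnorm.
    * crw H1. crw H2. rewrite V1, V2. crw Eb. now crw Db.
- intros v V1 V2. apply J1.
  + crw Ma. rewrite (mult_unit_l (gr_dom_unit G) (gr_pullback G) (@gr_comp_unit_l _ G)).
    * crw G2. rewrite V2. now cnorm.
    * crw G1. crw G2. rewrite V1, V2. crw Ea. now crw Ca.
  + crw Mb. rewrite (mult_unit_l (gr_dom_unit H) (gr_pullback H) (@gr_comp_unit_l _ H)).
    * crw H2. rewrite V2. now cnorm.
    * crw H1. crw H2. rewrite V1, V2. crw Eb. now crw Cb.
- exists d, c, e, s.
  exists (@graph_functor C HC (groupoid_of s) G a0 a1 (eq_sym Da) (eq_sym Ca) Ea).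
  exists (@graph_functor C HC (groupoid_of s) H b0 b1 (eq_sym Db) (eq_sym Cb) Eb).
  do 4 (split; [reflexivity|]). now apply levelwise_pullback.
Qed.

Lemma groupoids_have_pullbacks : has_pullbacks (Grpd C).
Proof.
intros G H Z F F'.
pose proof (pullbacks (maltsev_complete HM)) as HP.
destruct (HP _ _ _ (if_ob F) (if_ob F')) as [p0 [a0 [b0 P0]]].
destruct (HP _ _ _ (if_arr F) (if_arr F')) as [p1 [a1 [b1 P1]]].
destruct (pullback_of_groupoids P0 P1) as (d & c & e & s & A & B & _ & _ & _ & _ & K).
exists (groupoid_of s), A, B; exact K.
Qed.

End PullbacksOfGroupoids.

Definition preserves_pullbacks (D C : Category) (Φ : Functor D C) : Prop :=
  forall (a b z p : D) (f : hom a z) (g : hom b z) (p1 : hom p a) (p2 : hom p b),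
    is_pullback f g p1 p2 ->
    is_pullback (fmap Φ f) (fmap Φ g) (fmap Φ p1) (fmap Φ p2).

(** By uniqueness of pullbacks up to isomorphism, preservation can be tested on one pullback
    of each cospan. *)
Lemma preserved_pullback_transfer (D C : Category) (Φ : Functor D C) (a b z p p' : D)
    (f : hom a z) (g : hom b z) (p1 : hom p a) (p2 : hom p b)
    (p1' : hom p' a) (p2' : hom p' b) :
  is_pullback f g p1 p2 -> is_pullback f g p1' p2' ->
  is_pullback (fmap Φ f) (fmap Φ g) (fmap Φ p1') (fmap Φ p2') ->
  is_pullback (fmap Φ f) (fmap Φ g) (fmap Φ p1) (fmap Φ p2).
Proof.
intros HP HP' HΦ.
destruct (pullback_lift HP (proj1 HP')) as [i [I1 I2]].
destruct (pullback_lift HP' (proj1 HP)) as [j [J1 J2]].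
assert (E : i ∘ j = idm p).
{ apply (pullback_jointly_monic HP); rewrite comp_assoc, ?I1, ?I2, comp_idr; auto. }
apply pullback_intro.
- rewrite <- !fmap_comp. now rewrite (proj1 HP).
- intros x u v E1 E2.
  rewrite <- (comp_idl u), <- (comp_idl v), <- fmap_id, <- E, fmap_comp, <- !comp_assoc.
  f_equal. apply (pullback_jointly_monic HΦ);
    now rewrite !comp_assoc, <- !fmap_comp, ?J1, ?J2.
- intros x u v Euv. destruct (pullback_lift HΦ Euv) as [w [W1 W2]].
  exists (fmap Φ i ∘ w). now rewrite !comp_assoc, <- !fmap_comp, I1, I2.
Qed.

Lemma ob_preserves_pullbacks (C : Category) :
  maltsev_category C -> preserves_pullbacks (ob_functor C).
Proof.
intros HM G H Z K F F' A B HK.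
pose proof (pullbacks (maltsev_complete HM)) as HP.
destruct (HP _ _ _ (if_ob F) (if_ob F')) as [p0 [a0 [b0 P0]]].
destruct (HP _ _ _ (if_arr F) (if_arr F')) as [p1 [a1 [b1 P1]]].
destruct (pullback_of_groupoids HM P0 P1)
  as (d & c & e & s & A' & B' & <- & <- & <- & <- & HK').
exact (@preserved_pullback_transfer (Grpd C) C (ob_functor C) _ _ _ _ _ _ _ _ _ _ _
  HK HK' P0).
Qed.

Lemma arr_preserves_pullbacks (C : Category) :
  maltsev_category C -> preserves_pullbacks (arr_functor C).
Proof.
intros HM G H Z K F F' A B HK.
pose proof (pullbacks (maltsev_complete HM)) as HP.
destruct (HP _ _ _ (if_ob F) (if_ob F')) as [p0 [a0 [b0 P0]]].
destruct (HP _ _ _ (if_arr F) (if_arr F')) as [p1 [a1 [b1 P1]]].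
destruct (pullback_of_groupoids HM P0 P1)
  as (d & c & e & s & A' & B' & <- & <- & <- & <- & HK').
exact (@preserved_pullback_transfer (Grpd C) C (arr_functor C) _ _ _ _ _ _ _ _ _ _ _
  HK HK' P1).
Qed.

Section Evaluation.
Variables (D C : Category) (HM : maltsev_category C) (Φ : Functor D C).
Hypothesis HΦ : preserves_pullbacks Φ.
Variable G : Groupoid D.

Let Hd : fmap Φ (gr_dom G) ∘ fmap Φ (gr_unit G) = idm _.
Proof. now rewrite <- fmap_comp, gr_dom_unit, fmap_id. Qed.

Let Hc : fmap Φ (gr_cod G) ∘ fmap Φ (gr_unit G) = idm _.
Proof. now rewrite <- fmap_comp, gr_cod_unit, fmap_id. Qed.

Lemma evaluation_lift (g f : hom (gr_arr G) (gr_arr G))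
    (w : hom (Φ (gr_arr G)) (Φ (gr_pairs G))) :
  gr_dom G ∘ g = gr_cod G ∘ f ->
  fmap Φ (gr_fst G) ∘ w = fmap Φ g -> fmap Φ (gr_snd G) ∘ w = fmap Φ f ->
  exists W, gr_fst G ∘ W = g /\ gr_snd G ∘ W = f /\ w = fmap Φ W.
Proof.
intros E W1 W2. destruct (pullback_lift (gr_pullback G) E) as [W [<- <-]].
exists W; repeat split.
apply (pullback_jointly_monic (HΦ (gr_pullback G))); now rewrite <- fmap_comp.
Qed.

(** The morphisms on which the two sides have to be compared come from [D], by
    [evaluation_lift]. *)
Lemma evaluation_pairs_generated (z : D) (u v : hom (gr_pairs G) z) :
  (forall w, gr_fst G ∘ w = idm _ -> gr_snd G ∘ w = gr_unit G ∘ gr_dom G ->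
     u ∘ w = v ∘ w) ->
  (forall w, gr_fst G ∘ w = gr_unit G ∘ gr_cod G -> gr_snd G ∘ w = idm _ ->
     u ∘ w = v ∘ w) ->
  fmap Φ u = fmap Φ v.
Proof.
intros H1 H2. apply (sections_jointly_epic HM Hd Hc (HΦ (gr_pullback G))); intros w.
- rewrite <- fmap_id, <- fmap_comp. intros W1 W2.
  destruct (@evaluation_lift (idm _) (gr_unit G ∘ gr_dom G) w) as [W [E1 [E2 ->]]]; auto.
  + crw (gr_cod_unit G). reflexivity.
  + rewrite <- !fmap_comp. f_equal. auto.
- rewrite <- fmap_id, <- fmap_comp. intros W1 W2.
  destruct (@evaluation_lift (gr_unit G ∘ gr_cod G) (idm _) w) as [W [E1 [E2 ->]]]; auto.
  + crw (gr_dom_unit G). reflexivity.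
  + rewrite <- !fmap_comp. f_equal. auto.
Qed.

(** Associativity concerns generalized elements in [C], which need not come from [D]; but only
    the unit laws have to be transported, by [multiplicative_graph_groupoid]. *)
Lemma evaluation_groupoid :
  inhabited (groupoid_structure (fmap Φ (gr_dom G)) (fmap Φ (gr_cod G))
    (fmap Φ (gr_unit G))).
Proof.
apply (@multiplicative_graph_groupoid C HM _ _ _ _ _ Hd Hc _ _ _ (HΦ (gr_pullback G))
  (fmap Φ (gr_comp G))); intros w.
- rewrite <- fmap_id, <- fmap_comp. intros W1 W2.
  destruct (@evaluation_lift (idm _) (gr_unit G ∘ gr_dom G) w) as [W [E1 [E2 ->]]]; auto.
  + crw (gr_cod_unit G). reflexivity.
  + rewrite <- fmap_comp. f_equal. now apply gr_comp_unit_r.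
- rewrite <- fmap_id, <- fmap_comp. intros W1 W2.
  destruct (@evaluation_lift (gr_unit G ∘ gr_cod G) (idm _) w) as [W [E1 [E2 ->]]]; auto.
  + crw (gr_dom_unit G). reflexivity.
  + rewrite <- fmap_comp. f_equal. now apply gr_comp_unit_l.
Qed.

End Evaluation.

Lemma groupoids_pairs_generated (C : Category) :
  maltsev_category C -> pairs_generated (Grpd C).
Proof.
intros HM G Z u v H1 H2. apply internal_functor_eq.
- exact (evaluation_pairs_generated HM (ob_preserves_pullbacks HM) H1 H2).
- exact (evaluation_pairs_generated HM (arr_preserves_pullbacks HM) H1 H2).
Qed.

(** * Quotients of groupoids *)

Section Quotient.
Variables (C : Category) (HC : regular_category C) (HM : maltsev_category C).
Variables (G : Groupoid C) (x0 x1 : C) (d c : hom x1 x0) (e : hom x0 x1).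
Hypotheses (Hd : d ∘ e = idm x0) (Hc : c ∘ e = idm x0).
Variables (f0 : hom (gr_ob G) x0) (f1 : hom (gr_arr G) x1).
Hypotheses (Fd : d ∘ f1 = f0 ∘ gr_dom G) (Fc : c ∘ f1 = f0 ∘ gr_cod G)
  (Fe : f1 ∘ gr_unit G = e ∘ f0) (Hf : strict_epi f1).
Variables (P : C) (fst snd : hom P x1).
Hypothesis HP : is_pullback d c fst snd.
Variable p : hom (gr_pairs G) P.
Hypotheses (P1 : fst ∘ p = f1 ∘ gr_fst G) (P2 : snd ∘ p = f1 ∘ gr_snd G).

(** The image of [p] contains the pairs (f, 1) and (1, g), since these lift to pairs
    of the same form. *)
Lemma quotient_pairs_strict_epi : strict_epi p.
Proof.
destruct (image_factorization HC p) as [m [r [i [Hr [Hi E]]]]].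
destruct (pullback_lift (gr_pullback G) (u := idm _) (v := gr_unit G ∘ gr_dom G))
  as [a [A1 A2]].
{ crw (gr_cod_unit G). reflexivity. }
destruct (pullback_lift (gr_pullback G) (u := gr_unit G ∘ gr_cod G) (v := idm _))
  as [b [B1 B2]].
{ crw (gr_dom_unit G). reflexivity. }
pose proof (pullback_jointly_monic HP) as J.
destruct (proj2 Hf _ (r ∘ a)) as [a' A'].
{ intros t u v Euv. apply Hi. rewrite !(comp_assoc i), E.
  apply J; cnorm.
  - crw P1. crw A1. exact Euv.
  - crw P2. crw A2. crw Fe. crw <- Fd. now rewrite Euv. }
destruct (proj2 Hf _ (r ∘ b)) as [b' B'].
{ intros t u v Euv. apply Hi. rewrite !(comp_assoc i), E.
  apply J; cnorm.
  - crw P1. crw B1. crw Fe. crw <- Fc. now rewrite Euv.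
  - crw P2. crw B2. exact Euv. }
destruct (@subobject_containing_sections C HM _ _ _ _ d c e e fst snd Hc HP
  m i a' b' Hi) as [k Hk].
- apply (proj1 Hf). crw A'. crw E. crw P1. crw A1. reflexivity.
- apply (proj1 Hf). crw A'. crw E. crw P2. crw A2. crw Fe. now crw Fd.
- apply (proj1 Hf). crw B'. crw E. crw P1. crw B1. crw Fe. now crw Fc.
- apply (proj1 Hf). crw B'. crw E. crw P2. crw B2. reflexivity.
- assert (Hk' : k ∘ i = idm m).
  { apply Hi. rewrite comp_assoc, Hk. now cnorm. }
  split.
  + intros x u v Euv. rewrite <- E, !comp_assoc in Euv. apply (proj1 Hr) in Euv.
    rewrite <- (comp_idr u), <- (comp_idr v), <- Hk, !comp_assoc. now rewrite Euv.
  + intros x g Hg. destruct (proj2 Hr x g) as [h Hh].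
    * intros t u v Euv. apply Hg. rewrite <- E. cnorm. now rewrite Euv.
    * exists (h ∘ k). rewrite <- E. crw Hk'. exact Hh.
Qed.

(** The composition of [G] is compatible with the kernel pair of (f0, f1): this kernel
    pair is a reflexive graph, and the images by f1 of the two composites of pairs
    of its arrows agree on the pairs (f, 1) and (1, g). *)
Lemma quotient_comp_compatible (t : C) (u v : hom t (gr_pairs G)) :
  p ∘ u = p ∘ v -> f1 ∘ gr_comp G ∘ u = f1 ∘ gr_comp G ∘ v.
Proof.
intros E.
pose proof (pullbacks (maltsev_complete HM)) as HPb.
destruct (HPb _ _ _ f0 f0) as [k0 [l0 [r0 K0]]].
destruct (HPb _ _ _ f1 f1) as [k1 [l1 [r1 K1]]].
destruct (pullback_lift K0 (u := gr_dom G ∘ l1) (v := gr_dom G ∘ r1)) as [dk [Dl Dr]].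
{ crw <- Fd. now rewrite (proj1 K1). }
destruct (pullback_lift K0 (u := gr_cod G ∘ l1) (v := gr_cod G ∘ r1)) as [ck [Cl Cr]].
{ crw <- Fc. now rewrite (proj1 K1). }
destruct (pullback_lift K1 (u := gr_unit G ∘ l0) (v := gr_unit G ∘ r0)) as [ek [El Er]].
{ crw Fe. now rewrite (proj1 K0). }
destruct (HPb _ _ _ dk ck) as [R [s1 [s2 HR]]].
destruct (pullback_lift (gr_pullback G) (u := l1 ∘ s1) (v := l1 ∘ s2)) as [l [L1 L2]].
{ crw <- Dl. crw <- Cl. now rewrite (proj1 HR). }
destruct (pullback_lift (gr_pullback G) (u := r1 ∘ s1) (v := r1 ∘ s2)) as [r [R1 R2]].
{ crw <- Dr. crw <- Cr. now rewrite (proj1 HR). }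
assert (Elr : f1 ∘ gr_comp G ∘ l = f1 ∘ gr_comp G ∘ r).
{ apply (@sections_jointly_epic C HM _ _ _ _ dk ck ek ek s1 s2).
  - apply (pullback_jointly_monic K0).
    + crw Dl. crw El. crw (gr_dom_unit G). reflexivity.
    + crw Dr. crw Er. crw (gr_dom_unit G). reflexivity.
  - apply (pullback_jointly_monic K0).
    + crw Cl. crw El. crw (gr_cod_unit G). reflexivity.
    + crw Cr. crw Er. crw (gr_cod_unit G). reflexivity.
  - exact HR.
  - intros w W1 W2. cnorm.
    rewrite !(mult_unit_r (gr_cod_unit G) (gr_pullback G) (@gr_comp_unit_r _ G)).
    + crw L1. crw R1. rewrite W1. cnorm. apply K1.
    + crw R1. crw R2. rewrite W1, W2. crw Er. now crw Dr.
    + crw L1. crw L2. rewrite W1, W2. crw El. now crw Dl.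
  - intros w W1 W2. cnorm.
    rewrite !(mult_unit_l (gr_dom_unit G) (gr_pullback G) (@gr_comp_unit_l _ G)).
    + crw L2. crw R2. rewrite W2. cnorm. apply K1.
    + crw R1. crw R2. rewrite W1, W2. crw Er. now crw Cr.
    + crw L1. crw L2. rewrite W1, W2. crw El. now crw Cl. }
destruct (pullback_lift K1 (u := gr_fst G ∘ u) (v := gr_fst G ∘ v)) as [g [G1 G2]].
{ crw <- P1. now rewrite E. }
destruct (pullback_lift K1 (u := gr_snd G ∘ u) (v := gr_snd G ∘ v)) as [f [F1 F2]].
{ crw <- P2. now rewrite E. }
destruct (pullback_lift HR (u := g) (v := f)) as [w [W1 W2]].
{ apply (pullback_jointly_monic K0).
  - crw Dl. crw Cl. rewrite G1, F1. now crw (proj1 (gr_pullback G)).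
  - crw Dr. crw Cr. rewrite G2, F2. now crw (proj1 (gr_pullback G)). }
assert (Eu : u = l ∘ w).
{ apply (pullback_jointly_monic (gr_pullback G)).
  - crw L1. congruence.
  - crw L2. congruence. }
assert (Ev : v = r ∘ w).
{ apply (pullback_jointly_monic (gr_pullback G)).
  - crw R1. congruence.
  - crw R2. congruence. }
rewrite Eu, Ev, !comp_assoc. now rewrite Elr.
Qed.

End Quotient.

(** The composition descends along the strict epimorphism [p] from the pairs of [G] to those
    of the quotient. *)
Lemma quotient_groupoid (C : Category) (HC : regular_category C)
    (HM : maltsev_category C) (G : Groupoid C) (x0 x1 : C) (d c : hom x1 x0)
    (e : hom x0 x1) (f0 : hom (gr_ob G) x0) (f1 : hom (gr_arr G) x1) :
  d ∘ e = idm x0 -> c ∘ e = idm x0 ->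
  d ∘ f1 = f0 ∘ gr_dom G -> c ∘ f1 = f0 ∘ gr_cod G -> f1 ∘ gr_unit G = e ∘ f0 ->
  strict_epi f1 -> inhabited (groupoid_structure d c e).
Proof.
intros Hd Hc Fd Fc Fe Hf.
destruct (pullbacks (maltsev_complete HM) d c) as [P [fst [snd HP]]].
destruct (pullback_lift HP (u := f1 ∘ gr_fst G) (v := f1 ∘ gr_snd G)) as [p [P1 P2]].
{ crw Fd. crw Fc. now rewrite (proj1 (gr_pullback G)). }
destruct (quotient_pairs_strict_epi HC HM Hc Fd Fc Fe Hf HP P1 P2) as [_ Hp].
destruct (Hp _ (f1 ∘ gr_comp G)) as [m Hm].
{ exact (quotient_comp_compatible HM Fd Fc Fe P1 P2). }
apply (@multiplicative_graph_groupoid C HM x0 x1 d c e Hd Hc P fst snd HP m).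
- intros w W1 W2. apply (proj1 Hf).
  destruct (pullback_lift (gr_pullback G) (u := idm _) (v := gr_unit G ∘ gr_dom G))
    as [a [A1 A2]].
  { crw (gr_cod_unit G). reflexivity. }
  assert (E : w ∘ f1 = p ∘ a).
  { apply (pullback_jointly_monic HP).
    - crw W1. crw P1. rewrite A1. now cnorm.
    - crw W2. crw P2. rewrite A2. crw Fe. now crw Fd. }
  cnorm. rewrite E. crw Hm. rewrite (gr_comp_unit_r A1 A2). now cnorm.
- intros w W1 W2. apply (proj1 Hf).
  destruct (pullback_lift (gr_pullback G) (u := gr_unit G ∘ gr_cod G) (v := idm _))
    as [a [A1 A2]].
  { crw (gr_dom_unit G). reflexivity. }
  assert (E : w ∘ f1 = p ∘ a).
  { apply (pullback_jointly_monic HP).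
    - crw W1. crw P1. rewrite A1. crw Fe. now crw Fc.
    - crw W2. crw P2. rewrite A2. now cnorm. }
  cnorm. rewrite E. crw Hm. rewrite (gr_comp_unit_l A1 A2). now cnorm.
Qed.

(** * Double groupoids *)

Section DoubleGroupoid.
Variables (C : Category) (HM : maltsev_category C).
Variables (Z0 Z1 : Groupoid C) (dd cc : InternalFunctor Z1 Z0) (uu : InternalFunctor Z0 Z1).
Variable s0 : groupoid_structure (if_ob dd) (if_ob cc) (if_ob uu).
Variable s1 : groupoid_structure (if_arr dd) (if_arr cc) (if_arr uu).

Let HC : pairs_generated C := maltsev_pairs_generated HM.

Let dom_functor : InternalFunctor (groupoid_of s1) (groupoid_of s0) :=
  @graph_functor C HC (groupoid_of s1) (groupoid_of s0) (gr_dom Z0) (gr_dom Z1)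
    (eq_sym (if_dom dd)) (eq_sym (if_dom cc)) (if_dom uu).

Let cod_functor : InternalFunctor (groupoid_of s1) (groupoid_of s0) :=
  @graph_functor C HC (groupoid_of s1) (groupoid_of s0) (gr_cod Z0) (gr_cod Z1)
    (eq_sym (if_cod dd)) (eq_sym (if_cod cc)) (if_cod uu).

Let unit_functor : InternalFunctor (groupoid_of s0) (groupoid_of s1) :=
  @graph_functor C HC (groupoid_of s0) (groupoid_of s1) (gr_unit Z0) (gr_unit Z1)
    (if_unit dd) (if_unit cc) (eq_sym (if_unit uu)).

(** The composition and the inverse of the groupoid are internal functors, because the
    domain, the codomain and the unit of [Z0] and [Z1] form functors between the groupoids
    given by [s0] and [s1]. *)
Lemma levelwise_groupoid : inhabited (@groupoid_structure (Grpd C) Z0 Z1 dd cc uu).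
Proof.
destruct (pullback_of_groupoids HM (gs_pullback s0) (gs_pullback s1))
  as (dk & ck & ek & s & A & B & A0 & A1 & B0 & B1 & HK).
set (K := groupoid_of s) in *.
assert (M : exists M : InternalFunctor K Z1, if_ob M = gs_comp s0 /\ if_arr M = gs_comp s1).
{ unshelve eexists (@graph_functor C HC K Z1 (gs_comp s0) (gs_comp s1) _ _ _);
    [| | | split; reflexivity].
  - apply (if_comp (i := dom_functor)); simpl; rewrite <- ?A0, <- ?B0, <- ?A1, <- ?B1.
    + exact (eq_sym (if_dom A)).
    + exact (eq_sym (if_dom B)).
  - apply (if_comp (i := cod_functor)); simpl; rewrite <- ?A0, <- ?B0, <- ?A1, <- ?B1.
    + exact (eq_sym (if_cod A)).
    + exact (eq_sym (if_cod B)).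
  - symmetry.
    apply (if_comp (i := unit_functor)); simpl; rewrite <- ?A0, <- ?B0, <- ?A1, <- ?B1.
    + exact (if_unit A).
    + exact (if_unit B). }
destruct M as [M [M0 M1]].
pose (I := @graph_functor C HC Z1 Z1 (gs_inv s0) (gs_inv s1)
  (functor_inv HM dom_functor) (functor_inv HM cod_functor)
  (eq_sym (functor_inv HM unit_functor))).
assert (HA : forall T (w : InternalFunctor T K) v, internal_comp A w = v ->
  gs_fst s0 ∘ if_ob w = if_ob v /\ gs_fst s1 ∘ if_arr w = if_arr v).
{ intros T w v <-. rewrite <- A0, <- A1. now split. }
assert (HB : forall T (w : InternalFunctor T K) v, internal_comp B w = v ->
  gs_snd s0 ∘ if_ob w = if_ob v /\ gs_snd s1 ∘ if_arr w = if_arr v).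
{ intros T w v <-. rewrite <- B0, <- B1. now split. }
constructor.
refine (@Build_groupoid_structure (Grpd C) Z0 Z1 dd cc uu K A B M I HK
  _ _ _ _ _ _ _ _ _ _ _); intros; apply internal_functor_eq; simpl;
  rewrite ?M0, ?M1, ?A0, ?A1, ?B0, ?B1.
- apply (gs_dom_unit s0).
- apply (gs_dom_unit s1).
- apply (gs_cod_unit s0).
- apply (gs_cod_unit s1).
- apply (gs_dom_comp s0).
- apply (gs_dom_comp s1).
- apply (gs_cod_comp s0).
- apply (gs_cod_comp s1).
- apply gs_comp_unit_r; [apply (HA _ _ _ H) | apply (HB _ _ _ H0)].
- apply gs_comp_unit_r; [apply (HA _ _ _ H) | apply (HB _ _ _ H0)].
- apply gs_comp_unit_l; [apply (HA _ _ _ H) | apply (HB _ _ _ H0)].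
- apply gs_comp_unit_l; [apply (HA _ _ _ H) | apply (HB _ _ _ H0)].
- apply (@gs_comp_assoc _ _ _ _ _ _ s0 _ (if_ob hg) (if_ob gf)).
  + rewrite (proj1 (HB _ _ _ H)). simpl. now rewrite A0.
  + rewrite (proj1 (HA _ _ _ H0)). simpl. now rewrite M0.
  + rewrite (proj1 (HB _ _ _ H1)). simpl. now rewrite B0.
  + rewrite (proj1 (HA _ _ _ H2)). simpl. now rewrite A0.
  + rewrite (proj1 (HB _ _ _ H3)). simpl. now rewrite M0.
- apply (@gs_comp_assoc _ _ _ _ _ _ s1 _ (if_arr hg) (if_arr gf)).
  + rewrite (proj2 (HB _ _ _ H)). simpl. now rewrite A1.
  + rewrite (proj2 (HA _ _ _ H0)). simpl. now rewrite M1.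
  + rewrite (proj2 (HB _ _ _ H1)). simpl. now rewrite B1.
  + rewrite (proj2 (HA _ _ _ H2)). simpl. now rewrite A1.
  + rewrite (proj2 (HB _ _ _ H3)). simpl. now rewrite M1.
- apply gs_dom_inv.
- apply gs_dom_inv.
- apply gs_cod_inv.
- apply gs_cod_inv.
- apply gs_comp_inv_l; [apply (HA _ _ _ H) | apply (HB _ _ _ H0)].
- apply gs_comp_inv_l; [apply (HA _ _ _ H) | apply (HB _ _ _ H0)].
- apply gs_comp_inv_r; [apply (HA _ _ _ H) | apply (HB _ _ _ H0)].
- apply gs_comp_inv_r; [apply (HA _ _ _ H) | apply (HB _ _ _ H0)].
Qed.

End DoubleGroupoid.

(** * Discrete and indiscrete groupoids *)

Definition discrete_groupoid (D : Category) (x : D) : Groupoid D.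
Proof.
refine {| gr_ob := x; gr_arr := x; gr_dom := idm x; gr_cod := idm x; gr_unit := idm x;
  gr_pairs := x; gr_fst := idm x; gr_snd := idm x; gr_comp := idm x; gr_inv := idm x |};
  rewrite ?comp_idl; auto.
- split; [auto|]. intros t u v. rewrite !comp_idl. intros <-.
  exists u; split; [now rewrite comp_idl|].
  intros w [E _]. now rewrite comp_idl in E.
- intros t hg gf l r. rewrite !comp_idl. congruence.
Defined.

Section Discrete.
Variables (D : Category) (G : Groupoid D) (x : D).

Definition to_discrete (f : hom (gr_ob G) x) (E : f ∘ gr_dom G = f ∘ gr_cod G) :
  InternalFunctor G (discrete_groupoid x).
Proof.
refine (@Build_InternalFunctor D G (discrete_groupoid x) f (f ∘ gr_dom G) _ _ _ _);
  simpl; rewrite ?comp_idl; auto.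
- rewrite <- comp_assoc, gr_dom_unit. apply comp_idr.
- intros w _. rewrite !comp_idl, <- !comp_assoc. intros ->. now rewrite gr_dom_comp.
Defined.

Definition from_discrete (f : hom x (gr_ob G)) :
  InternalFunctor (discrete_groupoid x) G.
Proof.
refine (@Build_InternalFunctor D (discrete_groupoid x) G f (gr_unit G ∘ f) _ _ _ _);
  simpl; rewrite ?comp_idr; auto.
- rewrite comp_assoc, gr_dom_unit. apply comp_idl.
- rewrite comp_assoc, gr_cod_unit. apply comp_idl.
- intros w W1 W2.
  rewrite (mult_unit_r (gr_cod_unit G) (gr_pullback G) (@gr_comp_unit_r _ G));
    [now rewrite W1|].
  rewrite W1, W2. cnorm. now crw (gr_dom_unit G).
Defined.

End Discrete.

Definition is_discrete (D : Category) (G : Groupoid D) : Prop := is_iso (gr_unit G).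

Lemma discrete_dom (D : Category) (G : Groupoid D) :
  is_discrete G -> gr_unit G ∘ gr_dom G = idm (gr_arr G).
Proof.
intros [g [E1 E2]].
assert (E : g = gr_dom G).
{ rewrite <- (comp_idl g), <- (gr_dom_unit G). crw E2. reflexivity. }
now rewrite <- E.
Qed.

Lemma discrete_dom_cod (D : Category) (G : Groupoid D) :
  is_discrete G -> gr_dom G = gr_cod G.
Proof.
intros H. rewrite <- (comp_idr (gr_cod G)), <- (discrete_dom H).
crw (gr_cod_unit G). reflexivity.
Qed.

Lemma discrete_intro (D : Category) (G : Groupoid D) :
  gr_unit G ∘ gr_dom G = idm (gr_arr G) -> is_discrete G.
Proof. intros E. exists (gr_dom G). split; [apply gr_dom_unit | exact E]. Qed.

Lemma functor_from_discrete_arr (D : Category) (X G : Groupoid D)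
    (F : InternalFunctor X G) :
  is_discrete X -> if_arr F = gr_unit G ∘ (if_ob F ∘ gr_dom X).
Proof.
intros HX. rewrite <- (comp_idr (if_arr F)), <- (discrete_dom HX).
now crw (if_unit F).
Qed.

Lemma functor_to_discrete_arr (D : Category) (G X : Groupoid D)
    (F : InternalFunctor G X) :
  is_discrete X -> if_arr F = gr_unit X ∘ (if_ob F ∘ gr_dom G).
Proof.
intros HX. rewrite <- (if_dom F). crw (discrete_dom HX). reflexivity.
Qed.

(** Taking the object of objects is right adjoint to taking the discrete groupoid. *)
Lemma monic_ob (D : Category) (G X : Groupoid D) (F : InternalFunctor G X) :
  @monic (Grpd D) G X F -> monic (if_ob F).
Proof.
intros HF t u v E.
assert (E' : @comp (Grpd D) _ _ _ F (from_discrete u) =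
             @comp (Grpd D) _ _ _ F (from_discrete v)).
{ apply internal_functor_eq; simpl; [exact E|]. crw (if_unit F). now rewrite E. }
exact (f_equal (fmap (ob_functor D)) (HF _ _ _ E')).
Qed.

(** As [F] is monic on objects, domains and codomains agree in [G] because they do in [X];
    then replacing each arrow of [G] by the identity of its domain is an endofunctor
    that [F] cannot distinguish from the identity. *)
Lemma discrete_subobject (D : Category) (G X : Groupoid D) (F : InternalFunctor G X) :
  @monic (Grpd D) G X F -> is_discrete X -> is_discrete G.
Proof.
intros HF HX.
assert (E : idm _ ∘ gr_dom G = idm _ ∘ gr_cod G).
{ apply (monic_ob HF). rewrite !comp_idl, <- if_dom, <- if_cod. now rewrite (discrete_dom_cod HX). }
apply discrete_intro.
assert (E' : @comp (Grpd D) _ _ _ (from_discrete (idm (gr_ob G))) (to_discrete E)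
             = @idm (Grpd D) G).
{ apply HF. apply internal_functor_eq; simpl; cnorm; [reflexivity|].
  rewrite (functor_to_discrete_arr F HX). cnorm. now crw (gr_dom_unit G). }
apply (f_equal (fmap (arr_functor D))) in E'. simpl in E'.
now rewrite comp_idr, comp_idl in E'.
Qed.

Section Indiscrete.
Variables (D : Category) (x p : D) (p1 p2 : hom p x) (Hp : is_product p1 p2).
Variables (k : D) (k1 k2 : hom k p) (Hk : is_pullback p1 p2 k1 k2).

(** An arrow is the pair of its domain and codomain. *)
Lemma indiscrete_structure (e : hom x p) :
  p1 ∘ e = idm x -> p2 ∘ e = idm x -> inhabited (groupoid_structure p1 p2 e).
Proof.
intros E1 E2.
destruct (product_pair Hp (p1 ∘ k2) (p2 ∘ k1)) as [m [M1 M2]].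
destruct (product_pair Hp p2 p1) as [i [I1 I2]].
pose proof (product_jointly_monic Hp) as J.
constructor.
refine (@Build_groupoid_structure D x p p1 p2 e k k1 k2 m i Hk E1 E2 M1 M2
  _ _ _ I1 I2 _ _).
- intros w W1 W2. apply J.
  + crw M1. rewrite W2. now crw E1.
  + crw M2. rewrite W1. now cnorm.
- intros w W1 W2. apply J.
  + crw M1. rewrite W2. now cnorm.
  + crw M2. rewrite W1. now crw E2.
- intros t hg gf l r H L1 L2 R1 R2. apply J.
  + crw M1. rewrite L2, R2. now crw M1.
  + crw M2. rewrite L1, R1. now crw M2.
- intros w W1 W2. apply J.
  + crw M1. rewrite W2. crw E1. reflexivity.
  + crw M2. rewrite W1, I2. now crw E2.
- intros w W1 W2. apply J.
  + crw M1. rewrite W2, I1. now crw E1.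
  + crw M2. rewrite W1. crw E2. reflexivity.
Qed.

End Indiscrete.

Lemma indiscrete_groupoid (D : Category) : has_products D -> has_pullbacks D ->
  forall x : D, exists (p : D) (p1 p2 : hom p x) (e : hom x p),
    is_product p1 p2 /\ inhabited (groupoid_structure p1 p2 e).
Proof.
intros H1 H2 x. destruct (H1 x x) as [p [p1 [p2 Hp]]].
destruct (H2 _ _ _ p1 p2) as [k [k1 [k2 Hk]]].
destruct (product_pair Hp (idm x) (idm x)) as [e [E1 E2]].
exists p, p1, p2, e; split; [exact Hp|].
exact (indiscrete_structure Hp Hk E1 E2).
Qed.

Section ObjectsOfCoequalizers.
Variables (D : Category) (HPr : has_products D) (HPb : has_pullbacks D).

Lemma to_indiscrete (N G : Groupoid D) (f : hom (gr_ob G) (gr_ob N)) :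
  is_product (gr_dom N) (gr_cod N) -> exists F : InternalFunctor G N, if_ob F = f.
Proof.
intros HN. pose proof (product_jointly_monic HN) as J.
destruct (product_pair HN (f ∘ gr_dom G) (f ∘ gr_cod G)) as [f1 [E1 E2]].
unshelve eexists (@Build_InternalFunctor D G N f f1 E1 E2 _ _); [| | reflexivity].
- apply J.
  + crw E1. crw (gr_dom_unit G). crw (gr_dom_unit N). reflexivity.
  + crw E2. crw (gr_cod_unit G). crw (gr_cod_unit N). reflexivity.
- intros w W1 W2. apply J.
  + crw E1. crw (gr_dom_comp N). rewrite W2. crw E1. now rewrite gr_dom_comp.
  + crw E2. crw (gr_cod_comp N). rewrite W1. crw E2. now rewrite gr_cod_comp.
Qed.

Lemma to_indiscrete_unique (N G : Groupoid D) (F F' : InternalFunctor G N) :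
  is_product (gr_dom N) (gr_cod N) -> if_ob F = if_ob F' -> F = F'.
Proof.
intros HN E. apply internal_functor_eq; [exact E|].
apply (product_jointly_monic HN); rewrite ?if_dom, ?if_cod; now rewrite E.
Qed.

(** Taking the object of objects is left adjoint to taking the indiscrete groupoid. *)
Lemma coequalizer_ob (B X A : Groupoid D) (U V : InternalFunctor B X)
    (F : InternalFunctor X A) :
  @is_coequalizer (Grpd D) B X A U V F ->
  is_coequalizer (if_ob U) (if_ob V) (if_ob F).
Proof.
intros [E HF]. split; [exact (functor_square_ob E)|].
intros x g Eg.
destruct (indiscrete_groupoid HPr HPb x) as (p & p1 & p2 & e & Hp & [s]).
set (N := groupoid_of s). assert (HN : is_product (gr_dom N) (gr_cod N)) by exact Hp.
destruct (@to_indiscrete N X g HN) as [G HG].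
destruct (HF N G) as [H [HH Hu]].
{ apply (to_indiscrete_unique HN). simpl. now rewrite HG. }
exists (if_ob H); split.
- rewrite <- HG. exact (f_equal (fmap (ob_functor D)) HH).
- intros h Hh. destruct (@to_indiscrete N A h HN) as [H' HH'].
  rewrite <- HH'. apply f_equal, Hu, (to_indiscrete_unique HN). simpl.
  rewrite HG, HH'. exact Hh.
Qed.

End ObjectsOfCoequalizers.

(** The inclusion in [A] of the discrete groupoid on its objects is a monomorphism.  As [F]
    factors through it, it is also a split epimorphism. *)
Lemma discrete_quotient (D : Category) (X A : Groupoid D) (F : InternalFunctor X A) :
  @regular_epi (Grpd D) X A F -> is_discrete X -> is_discrete A.
Proof.
intros HF HX. destruct (regular_epi_strict HF) as [He Hs].
assert (E : if_ob F ∘ gr_dom X = if_ob F ∘ gr_cod X) by now rewrite (discrete_dom_cod HX).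
destruct (Hs _ (to_discrete E)) as [H HH].
{ intros T U V EUV. pose proof (functor_square_ob EUV) as E0.
  apply internal_functor_eq; simpl; [exact E0|].
  cnorm. rewrite !if_dom. now crw E0. }
assert (K : @comp (Grpd D) _ _ _ (from_discrete (idm (gr_ob A))) H = @idm (Grpd D) A).
{ apply He. rewrite <- comp_assoc, HH, comp_idl. apply internal_functor_eq; simpl.
  - apply comp_idl.
  - cnorm. symmetry. now apply functor_from_discrete_arr. }
apply discrete_intro.
assert (K0 : if_ob H = idm _).
{ rewrite <- (comp_idl (if_ob H)). exact (f_equal (fmap (ob_functor D)) K). }
assert (K1 : gr_unit A ∘ if_arr H = idm _).
{ rewrite <- (comp_idr (gr_unit A)). exact (f_equal (fmap (arr_functor D)) K). }
rewrite <- K1. f_equal.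
transitivity (if_ob H ∘ gr_dom A); [rewrite K0; now cnorm|].
rewrite <- (if_dom H). apply comp_idl.
Qed.

Lemma groupoids_have_products (C : Category) :
  maltsev_category C -> has_products (Grpd C).
Proof.
intros HM. destruct (terminal_object (maltsev_complete HM)) as [z Hz].
assert (Hu : forall x (f g : hom x z), f = g).
{ intros x f g. destruct (Hz x) as [t [_ Ht]]. now rewrite <- (Ht f), <- (Ht g). }
assert (HZ : @is_terminal (Grpd C) (discrete_groupoid z)).
{ intros G. destruct (Hz (gr_ob (G : Groupoid C))) as [f _].
  exists (to_discrete (Hu _ (f ∘ gr_dom G) (f ∘ gr_cod G))). split; [exact I|].
  intros F _. apply internal_functor_eq; apply Hu. }
intros G H. destruct (HZ G) as [F _], (HZ H) as [F' _].
destruct (groupoids_have_pullbacks HM F F') as (p & p1 & p2 & Hp).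
exists p, p1, p2. exact (pullback_over_terminal HZ Hp).
Qed.

(** * The reflection of double groupoids in 2-groupoids *)

Lemma epic_square (C : Category) (a0 a1 q0 q1 x0 x1 : C) (da : hom a1 a0)
    (dq : hom q1 q0) (dx : hom x1 x0) (eta0 : hom a0 q0) (eta1 : hom a1 q1)
    (h0 : hom q0 x0) (h1 : hom q1 x1) (f0 : hom a0 x0) (f1 : hom a1 x1) :
  epic eta1 -> dq ∘ eta1 = eta0 ∘ da -> h0 ∘ eta0 = f0 -> h1 ∘ eta1 = f1 ->
  dx ∘ f1 = f0 ∘ da -> dx ∘ h1 = h0 ∘ dq.
Proof. intros He E <- <- Ex. apply He. cnorm. rewrite E, Ex. now cnorm. Qed.

Section Reflection.
Variables (C : Category) (HR : regular_category C) (HM : maltsev_category C).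
Variables (A0 A1 : Groupoid C) (dd cc : InternalFunctor A1 A0) (uu : InternalFunctor A0 A1).
Variable v0 : groupoid_structure (if_ob dd) (if_ob cc) (if_ob uu).
Variable v1 : groupoid_structure (if_arr dd) (if_arr cc) (if_arr uu).
Variables (P : C) (q : hom (gr_ob A0) P).
Hypothesis Hq : is_coequalizer (gr_dom A0) (gr_cod A0) q.
Variables (Q0 Q1 : C) (r0 : hom (gr_ob A1) Q0) (n0 : hom P Q0)
  (r1 : hom (gr_arr A1) Q1) (n1 : hom P Q1).
Hypothesis H0 : is_strict_pushout (if_ob uu) q r0 n0.
Hypothesis H1 : is_strict_pushout (if_arr uu) (q ∘ gr_dom A0) r1 n1.

Let HC : pairs_generated C := maltsev_pairs_generated HM.

Let Eq : q ∘ gr_dom A0 = q ∘ gr_cod A0 := proj1 Hq.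

Let eta0 : InternalFunctor A0 (discrete_groupoid P) := to_discrete Eq.

(** The pushouts [Q0] and [Q1] form a horizontal graph covered by [A1], and each of them is
    the object of arrows of a vertical graph on [P] covered by one of [v0] and [v1]; so the
    three are groupoids by [quotient_groupoid]. *)
Lemma reflection_structure :
  exists (d c : hom Q1 Q0) (e : hom Q0 Q1) (s : groupoid_structure d c e)
    (dq cq : InternalFunctor (groupoid_of s) (discrete_groupoid P))
    (uq : InternalFunctor (discrete_groupoid P) (groupoid_of s))
    (eta1 : InternalFunctor A1 (groupoid_of s)),
    if_ob eta1 = r0 /\ if_arr eta1 = r1 /\ if_ob uq = n0 /\ if_arr uq = n1 /\
    internal_comp dq eta1 = internal_comp eta0 dd /\
    internal_comp cq eta1 = internal_comp eta0 cc /\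
    internal_comp eta1 uu = internal_comp uq eta0 /\
    inhabited (@groupoid_structure (Grpd C) _ _ dq cq uq).
Proof.
destruct H0 as [R0 [E0 L0]], H1 as [R1 [E1 L1]].
destruct (L1 _ (r0 ∘ gr_dom A1) n0) as [d [Dr Dn]].
{ crw (if_dom uu). now crw E0. }
destruct (L1 _ (r0 ∘ gr_cod A1) n0) as [c [Cr Cn]].
{ crw (if_cod uu). crw E0. now rewrite Eq. }
destruct (L0 _ (r1 ∘ gr_unit A1) n1) as [e [Er En]].
{ crw <- (if_unit uu). crw E1. crw (gr_dom_unit A0). reflexivity. }
assert (De : d ∘ e = idm Q0).
{ apply (proj1 R0). crw Er. crw Dr. crw (gr_dom_unit A1). reflexivity. }
assert (Ce : c ∘ e = idm Q0).
{ apply (proj1 R0). crw Er. crw Cr. crw (gr_cod_unit A1). reflexivity. }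
destruct (quotient_groupoid HR HM De Ce Dr Cr (eq_sym Er) R1) as [s].
destruct (L0 _ (q ∘ if_ob dd) (idm P)) as [d0 [D0r D0n]].
{ crw (gs_dom_unit v0). reflexivity. }
destruct (L0 _ (q ∘ if_ob cc) (idm P)) as [c0 [C0r C0n]].
{ crw (gs_cod_unit v0). reflexivity. }
destruct (L1 _ (q ∘ gr_dom A0 ∘ if_arr dd) (idm P)) as [d1 [D1r D1n]].
{ crw (gs_dom_unit v1). reflexivity. }
destruct (L1 _ (q ∘ gr_dom A0 ∘ if_arr cc) (idm P)) as [c1 [C1r C1n]].
{ crw (gs_cod_unit v1). reflexivity. }
destruct (@quotient_groupoid C HR HM (groupoid_of v0) P Q0 d0 c0 n0 q r0
  D0n C0n D0r C0r E0 R0) as [s0].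
destruct (@quotient_groupoid C HR HM (groupoid_of v1) P Q1 d1 c1 n1 (q ∘ gr_dom A0) r1
  D1n C1n D1r C1r E1 R1) as [s1].
exists d, c, e, s.
unshelve eexists (@graph_functor C HC (groupoid_of s) (discrete_groupoid P) d0 d1 _ _ _).
{ simpl. rewrite comp_idl. apply (proj1 R1). crw D1r. crw Dr. crw D0r.
  now crw (if_dom dd). }
{ simpl. rewrite comp_idl. apply (proj1 R1). crw D1r. crw Cr. crw D0r.
  rewrite comp_assoc, Eq. cnorm. now crw (if_cod dd). }
{ simpl. rewrite comp_idl. apply (proj1 R0). crw Er. crw D1r. crw D0r.
  crw (if_unit dd). now crw (gr_dom_unit A0). }
unshelve eexists (@graph_functor C HC (groupoid_of s) (discrete_groupoid P) c0 c1 _ _ _).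
{ simpl. rewrite comp_idl. apply (proj1 R1). crw C1r. crw Dr. crw C0r.
  now crw (if_dom cc). }
{ simpl. rewrite comp_idl. apply (proj1 R1). crw C1r. crw Cr. crw C0r.
  rewrite comp_assoc, Eq. cnorm. now crw (if_cod cc). }
{ simpl. rewrite comp_idl. apply (proj1 R0). crw Er. crw C1r. crw C0r.
  crw (if_unit cc). now crw (gr_dom_unit A0). }
unshelve eexists (@graph_functor C HC (discrete_groupoid P) (groupoid_of s) n0 n1 _ _ _).
{ simpl. now rewrite comp_idr. }
{ simpl. now rewrite comp_idr. }
{ simpl. now rewrite comp_idr. }
exists (@graph_functor C HC A1 (groupoid_of s) r0 r1 Dr Cr (eq_sym Er)).
do 4 (split; [reflexivity|]).
do 3 (split; [apply internal_functor_eq; simpl; auto; now rewrite <- comp_assoc|]).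
now apply (levelwise_groupoid HM).
Qed.

(** A functor to the discrete [X0] is constant on the connected components of [A0], hence
    factors through [P]; the pushouts then provide the factorization of [F1].  Being
    compatible with the graph structures can be tested after the epimorphism [eta1]. *)
Lemma reflection_lift (d c : hom Q1 Q0) (e : hom Q0 Q1) (s : groupoid_structure d c e)
    (dq cq : InternalFunctor (groupoid_of s) (discrete_groupoid P))
    (uq : InternalFunctor (discrete_groupoid P) (groupoid_of s))
    (eta1 : InternalFunctor A1 (groupoid_of s))
    (X0 X1 : Groupoid C) (dx cx : InternalFunctor X1 X0) (ux : InternalFunctor X0 X1)
    (F0 : InternalFunctor A0 X0) (F1 : InternalFunctor A1 X1) :
  if_ob eta1 = r0 -> if_arr eta1 = r1 -> if_ob uq = n0 -> if_arr uq = n1 ->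
  internal_comp dq eta1 = internal_comp eta0 dd ->
  internal_comp cq eta1 = internal_comp eta0 cc ->
  is_discrete X0 ->
  internal_comp dx F1 = internal_comp F0 dd ->
  internal_comp cx F1 = internal_comp F0 cc ->
  internal_comp F1 uu = internal_comp ux F0 ->
  exists (h0 : InternalFunctor (discrete_groupoid P) X0)
    (h1 : InternalFunctor (groupoid_of s) X1),
    internal_comp h0 eta0 = F0 /\ internal_comp h1 eta1 = F1 /\
    internal_comp dx h1 = internal_comp h0 dq /\
    internal_comp cx h1 = internal_comp h0 cq /\
    internal_comp h1 uq = internal_comp ux h0.
Proof.
intros O1 O2 O3 O4 Ed Ec HX Fd Fc Fu.
destruct H0 as [R0 [_ L0]], H1 as [R1 [_ L1]].
pose proof (proj1 (coequalizer_strict_epi Hq)) as Sq.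
destruct (proj2 Hq _ (if_ob F0)) as [k [Hk _]].
{ rewrite <- !if_dom, <- if_cod. now rewrite (discrete_dom_cod HX). }
pose (h0 := from_discrete k : InternalFunctor (discrete_groupoid P) X0).
assert (E0 : internal_comp h0 eta0 = F0).
{ apply internal_functor_eq; simpl; [exact Hk|].
  rewrite (functor_to_discrete_arr F0 HX), <- Hk. now cnorm. }
destruct (L0 _ (if_ob F1) (if_ob ux ∘ if_ob h0)) as [k0 [K0r K0n]].
{ rewrite (functor_square_ob Fu), <- Hk. now cnorm. }
destruct (L1 _ (if_arr F1) (if_arr ux ∘ if_arr h0)) as [k1 [K1r K1n]].
{ rewrite (functor_square_arr Fu), <- E0. simpl. now cnorm. }
subst r0 r1 n0 n1.
pose proof (if_dom eta1) as Td; pose proof (if_cod eta1) as Tc;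
  pose proof (if_unit eta1) as Tu; simpl in Td, Tc, Tu.
unshelve epose (h1 := @graph_functor C HC (groupoid_of s) X1 k0 k1 _ _ _).
{ simpl. apply (proj1 R1). crw K1r. crw Td. crw K0r. apply if_dom. }
{ simpl. apply (proj1 R1). crw K1r. crw Tc. crw K0r. apply if_cod. }
{ simpl. apply (proj1 R0). crw K0r. crw <- Tu. crw K1r. apply if_unit. }
assert (E1 : internal_comp h1 eta1 = F1) by now apply internal_functor_eq.
assert (He : @epic (Grpd C) _ _ eta1) by (apply levelwise_epic; [apply R0 | apply R1]).
exists h0, h1. do 2 (split; [assumption|]). split; [|split].
- exact (epic_square (C := Grpd C) He Ed E0 E1 Fd).
- exact (epic_square (C := Grpd C) He Ec E0 E1 Fc).
- now apply internal_functor_eq.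
Qed.

End Reflection.

(** The factorizations of [reflection_lift] are functors between double groupoids by
    [groupoids_pairs_generated], and they are unique because [eta] is an epimorphism in each
    component. *)
Lemma two_groupoid_reflection (C : Category) (HCo : finitely_cocomplete C)
    (HR : regular_category C) (HM : maltsev_category C) (A : Grpd2 C) :
  exists (Q : Grpd2 C) (eta : hom A Q), is_two_groupoid Q /\
    forall X : Grpd2 C, is_two_groupoid X ->
      forall F : hom A X, exists! H : hom Q X, H ∘ eta = F.
Proof.
pose proof (pullbacks (maltsev_complete HM)) as HPb.
pose (A0 := gr_ob (A : Groupoid (Grpd C)) : Groupoid C).
pose (A1 := gr_arr (A : Groupoid (Grpd C)) : Groupoid C).
pose (dd := gr_dom (A : Groupoid (Grpd C)) : InternalFunctor A1 A0).
pose (cc := gr_cod (A : Groupoid (Grpd C)) : InternalFunctor A1 A0).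
pose (uu := gr_unit (A : Groupoid (Grpd C)) : InternalFunctor A0 A1).
destruct (evaluation_groupoid HM (ob_preserves_pullbacks HM) A) as [v0].
destruct (evaluation_groupoid HM (arr_preserves_pullbacks HM) A) as [v1].
destruct (coequalizers HCo (gr_dom A0) (gr_cod A0)) as [P [q Hq]].
pose proof (coequalizer_strict_epi Hq) as Sq.
assert (Sq1 : strict_epi (q ∘ gr_dom A0))
  by exact (strict_epi_after_split (gr_dom_unit A0) Sq).
destruct (pushout_of_strict_epi HCo HPb (if_ob uu) Sq) as (Q0 & r0 & n0 & H0).
destruct (pushout_of_strict_epi HCo HPb (if_arr uu) Sq1) as (Q1 & r1 & n1 & H1).
destruct (@reflection_structure C HR HM A0 A1 dd cc uu v0 v1 P q Hq
  Q0 Q1 r0 n0 r1 n1 H0 H1)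
  as (d & c & e & s & dq & cq & uq & eta1 & O1 & O2 & O3 & O4 & Ed & Ec & Eu & [S]).
set (eta0 := to_discrete (proj1 Hq)) in *.
pose proof (groupoids_pairs_generated HM) as HG.
pose (Q := groupoid_of S).
pose (eta := @graph_functor (Grpd C) HG A Q eta0 eta1 Ed Ec Eu).
assert (He0 : @epic (Grpd C) _ _ eta0).
{ apply levelwise_epic; simpl; [apply Sq | apply Sq1]. }
assert (He1 : @epic (Grpd C) _ _ eta1).
{ apply levelwise_epic; rewrite ?O1, ?O2; [apply H0 | apply H1]. }
assert (Heta : @epic (Grpd2 C) A Q eta)
  by exact (@levelwise_epic (Grpd C) A Q eta He0 He1).
exists Q, eta; split.
{ exists (idm P). split; apply comp_idl. }
intros X HX F.
pose (FX := F : InternalFunctor (C := Grpd C) A X).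
destruct (@reflection_lift C HM A0 A1 dd cc uu P q Hq Q0 Q1 r0 n0 r1 n1 H0 H1
  d c e s dq cq uq eta1 _ _ (gr_dom (X : Groupoid (Grpd C)))
  (gr_cod (X : Groupoid (Grpd C))) (gr_unit (X : Groupoid (Grpd C)))
  (if_ob FX) (if_arr FX) O1 O2 O3 O4 Ed Ec HX (if_dom FX) (if_cod FX) (if_unit FX))
  as (h0 & h1 & E0 & E1 & Hd & Hc & Hu).
pose (H := @graph_functor (Grpd C) HG Q X h0 h1 Hd Hc Hu : hom (Q : Grpd2 C) X).
assert (HH : H ∘ (eta : hom A (Q : Grpd2 C)) = F)
  by exact (@internal_functor_eq (Grpd C) A X (@internal_comp (Grpd C) A Q X H eta) FX E0 E1).
exists H. split; [exact HH|].
intros H' HH'. apply Heta. now rewrite HH'.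
Qed.

(** * The Birkhoff property *)

Lemma reflective_of_universal_arrows (A : Category) (P : A -> Prop) :
  (forall a : A, exists (q : A) (eta : hom a q), P q /\
     forall x : A, P x -> forall f : hom a x, exists! h : hom q x, h ∘ eta = f) ->
  has_left_adjoint (inclusion P).
Proof.
intros H.
assert (U : forall a : A, {q : A & {eta : hom a q | P q /\
  forall x : A, P x -> forall f : hom a x, exists! h : hom q x, h ∘ eta = f}}).
{ intros a. destruct (constructive_indefinite_description _ (H a)) as [q Hq].
  exists q. exact (constructive_indefinite_description _ Hq). }
pose (q a := projT1 (U a)).
pose (eta a := proj1_sig (projT2 (U a)) : hom a (q a)).
assert (Pq : forall a, P (q a)) by (intros a; apply (proj2_sig (projT2 (U a)))).
assert (Hq : forall a x, P x -> forall f : hom a x, exists! h, h ∘ eta a = f)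
  by (intros a; apply (proj2_sig (projT2 (U a)))).
assert (Hu : forall a x (h h' : hom (q a) x), P x -> h ∘ eta a = h' ∘ eta a -> h = h').
{ intros a x h h' Hx E. destruct (Hq a x Hx (h ∘ eta a)) as [k [_ Hk]].
  transitivity k; [symmetry|]; apply Hk; auto. }
pose (ext a x (Hx : P x) (f : hom a x) :=
  proj1_sig (constructive_indefinite_description _ (Hq a x Hx f))).
assert (Hext : forall a x Hx f, ext a x Hx f ∘ eta a = f)
  by (intros a x Hx f; exact (proj1 (proj2_sig
       (constructive_indefinite_description _ (Hq a x Hx f))))).
pose (map a b (f : hom a b) := ext a (q b) (Pq b) (eta b ∘ f)).
assert (Hmap : forall a b f, @map a b f ∘ eta a = eta b ∘ f) by (intros; apply Hext).
clearbody map ext; clearbody eta.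
unshelve epose (L := @Build_Functor A (full_subcategory P)
    (fun a => exist _ (q a) (Pq a)) map _ _).
{ intros a. simpl. apply Hu; [apply Pq|]. rewrite Hmap. now rewrite comp_idl, comp_idr. }
{ intros a b c g f. simpl. apply Hu; [apply Pq|]. rewrite Hmap.
  now rewrite <- comp_assoc, Hmap, !comp_assoc, Hmap. }
exists L; constructor.
unshelve refine (@Build_Adjunction A (full_subcategory P) L (inclusion P)
  (fun a x (g : hom (q a) (proj1_sig x)) => g ∘ eta a)
  (fun a x f => ext a (proj1_sig x) (proj2_sig x) f) _ _ _ _); simpl.
- intros a x f. apply Hext.
- intros a x g. apply Hu; [exact (proj2_sig x)|]. apply Hext.
- intros a b x f g. now rewrite <- comp_assoc, Hmap, comp_assoc.
- intros a x y g h. now rewrite comp_assoc.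
Qed.

Theorem theorem2p1 (C : Category) :
  finitely_cocomplete C -> regular_category C -> maltsev_category C ->
  @birkhoff_subcategory (Grpd2 C) (@is_two_groupoid C).
Proof.
intros HCo HR HM.
assert (Sub : forall (A X : Grpd2 C) (f : hom A X),
  monic f -> is_two_groupoid X -> is_two_groupoid A).
{ intros A X f Hf HX.
  refine (@discrete_subobject C (gr_ob (A : Groupoid (Grpd C)))
    (gr_ob (X : Groupoid (Grpd C))) (if_ob (f : InternalFunctor _ _)) _ HX).
  exact (monic_ob Hf). }
split.
- intros A B [f [g [_ Hfg]]] HA. apply (Sub B A g); [|exact HA].
  intros T u v E.
  rewrite <- (comp_idl u), <- (comp_idl v), <- Hfg, <- !comp_assoc. now f_equal.
- apply reflective_of_universal_arrows. intros A.
  exact (two_groupoid_reflection HCo HR HM A).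
- exact Sub.
- intros X A f [B [U [V Hf]]] HX.
  refine (@discrete_quotient C (gr_ob (X : Groupoid (Grpd C)))
    (gr_ob (A : Groupoid (Grpd C))) (if_ob (f : InternalFunctor _ _)) _ HX).
  exists (gr_ob (B : Groupoid (Grpd C))), (if_ob (U : InternalFunctor _ _)),
    (if_ob (V : InternalFunctor _ _)).
  exact (coequalizer_ob (groupoids_have_products HM) (groupoids_have_pullbacks HM) Hf).
Qed.
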